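(* Let $\varphi$ be a quantifier-free formula of the extensional theory of arrays (with the index sort $I$ interpreted over infinite domains), and let $a$ be a variable of array sort $\mathrm{Arr}(I,V)$. Then $\textsc{ArrayQE}(\exists a\cdot\varphi)$ terminates in time exponential in the size of $\varphi$.
   Context: Setting: a many-sorted first-order language with equality whose sorts are basic sorts and array sorts $\mathrm{Arr}(I,V)$, with $I$ a basic sort of indices and $V$ a sort of values. For each array sort there are function symbols $\mathit{rd}:\mathrm{Arr}(I,V)\times I\to V$ and $\mathit{wr}:\mathrm{Arr}(I,V)\times I\times V\to\mathrm{Arr}(I,V)$, and no other symbols. The theory of arrays is axiomatized by read-after-write and extensionality. Standing assumption: the index sort $I$ is interpreted over infinite domains. For a vector $\vec{i}$ of index terms, $j\in\vec{i}$ abbreviates $\bigvee_k j=\vec{i}(k)$; $\mathit{wr}(a,\vec{i},\vec{v})$ denotes the iterated write; the partial equality $a=_{\vec{i}}b$ abbreviates $\forall j:I\cdot(j\notin\vec{i}\Rightarrow\mathit{rd}(a,j)=\mathit{rd}(b,j))$. $\varphi[t]$ denotes a formula with an occurrence of $t$ at some position. $\textsc{ArrayQE}(\exists a\cdot\varphi)$ is the following procedure. Step 1: apply to a fixed point (nondeterministically chosen): (ElimWrRd) $\varphi[\mathit{rd}(\mathit{wr}(t,i,v),j)]\leadsto(i=j\wedge\varphi[v])\vee(i\neq j\wedge\varphi[\mathit{rd}(t,j)])$; (ElimWrEq) $\varphi[\mathit{wr}(t_1,j,v)=_{\vec{i}}t_2]\leadsto(j\in\vec{i}\wedge\varphi[t_1=_{\vec{i}}t_2])\vee(j\notin\vec{i}\wedge\varphi[t_1=_{\vec{i},j}t_2\wedge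 v=\mathit{rd}(t_2,j)])$; (PartialEq) $\varphi[t_1=t_2]\leadsto\varphi[t_1=_{\emptyset}t_2]$ for array-sorted $t_1,t_2$; (TrivEq) $\varphi[t=_{\vec{i}}t]\leadsto\varphi[\top]$; (Symm) $\varphi[t_1=_{\vec{i}}t_2]\leadsto\varphi[t_2=_{\vec{i}}t_1]$ when $t_2$ is a write term and $t_1$ is not. Step 2: for each partial equality on $a$, exactly once, (CaseSplitEq) $\exists a\cdot\varphi[a=_{\vec{i}}t]\leadsto\exists a\cdot((a=_{\vec{i}}t\wedge\varphi[\top])\vee(\neg(a=_{\vec{i}}t)\wedge\varphi[\bot]))$; then for each read term over $a$, exactly once, (FactorRd) $\exists a\cdot\varphi[\mathit{rd}(a,t)]\leadsto\exists a,s\cdot(\varphi[s]\wedge s=\mathit{rd}(a,t))$ with $s$ fresh and $t$ without array terms. Step 3 (LiftEqDiseqRd): Boolean rewriting to an equivalent disjunction $\bigvee_{k=1}^n\delta_k$, each disjunct ending with conjuncts consisting of partial equalities on $a$, then array disequalities, then equalities over read terms on $a$. Step 4: for each $\delta_k$ apply (ElimEq) $\exists a\cdot(a=_{\vec{i}}t\wedge\varphi)\leadsto\exists\vec{v}\cdot\varphi[\mathit{wr}(t,\vec{i},\vec{v})/a]$ ($a$ not in $t$, $\vec{v}$ fresh); then (ElimDiseq) $\exists a\cdot(\varphi\wedge\bigwedge_k\neg(a=_{\vec{i}_k}t_k))\leadsto\exists a\cdot\varphi$ ($a$ not in the $t_k$, and occurring in $\varphi$ only in read terms); then (Ackermann)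 $\exists a\cdot(\varphi\wedge\bigwedge_{k=1}^m s_k=\mathit{rd}(a,t_k))\leadsto\varphi\wedge\bigwedge_{k<\ell}(t_k=t_\ell\Rightarrow s_k=s_\ell)$ ($a$ not in $\varphi$, $s_k$, $t_k$), obtaining $\psi_k$; return $\bigvee_k\psi_k$.
   Formalization: Rules rewrite one disjunct at a time and replace all occurrences of a term (one occurrence in the whole formula need not terminate); FactorRd requires only that t not mention a, not that t have no array terms; exponential means 2^poly(size), charging symbols read and written. *)

(* Defs.v *)
From Stdlib Require List.
From HB Require Import structures.
From mathcomp Require Import all_boot.

Set Implicit Arguments.
Unset Strict Implicit.
Unset Printing Implicit Defensive.

(* Indices are of basic sort; the value sort is arbitrary, so arrays may be
   nested in value position. *)
Inductive asort := Basic (b : nat) | Arr (J : nat) (V : asort).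

Definition asort_eq_dec : comparable asort.
Proof. by rewrite /comparable /decidable; decide equality; apply: eq_comparable. Defined.
HB.instance Definition _ := comparableMixin asort_eq_dec.

Definition var : Type := (asort * nat)%type.

Inductive term :=
| Var (x : var)
| Rd (t i : term)
| Wr (t i v : term).

Definition term_eq_dec : comparable term.
Proof. by rewrite /comparable /decidable; decide equality; apply: eq_comparable. Defined.
HB.instance Definition _ := comparableMixin term_eq_dec.

(* [PEq t js u] is the partial equality t =_js u, that is
   forall j, j \notin js -> rd(t,j) = rd(u,j); the procedure only ever handles it
   as an atom. *)
Inductive formula :=
| Top
| Bot
| Eq (t u : term)
| PEq (t : term) (js : seq term) (u : term)
| Not (f : formula)
| And (f g : formula)
| Or (f g : formula)
| Imp (f g : formula).

Definition formula_eq_dec : comparable formula.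
Proof. by rewrite /comparable /decidable; decide equality; apply: eq_comparable. Defined.
HB.instance Definition _ := comparableMixin formula_eq_dec.

Fixpoint sort_of (t : term) : option asort :=
  match t with
  | Var x => Some x.1
  | Rd t i =>
      if sort_of t is Some (Arr J V) then
        if sort_of i == Some (Basic J) then Some V else None
      else None
  | Wr t i v =>
      if sort_of t is Some (Arr J V) then
        if (sort_of i == Some (Basic J)) && (sort_of v == Some V)
        then Some (Arr J V) else None
      else None
  end.

Definition array_sorted (t : term) : bool :=
  if sort_of t is Some (Arr _ _) then true else false.

Fixpoint well_sorted (f : formula) : bool :=
  match f with
  | Top | Bot => true
  | Eq t u => isSome (sort_of t) && (sort_of t == sort_of u)
  | PEq t js u =>
      if sort_of t is Some (Arr J _) then
        (sort_of t == sort_of u) && all (fun i => sort_of i == Some (Basic J)) js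
      else false
  | Not f => well_sorted f
  | And f g | Or f g | Imp f g => well_sorted f && well_sorted g
  end.

(* A partial equality abbreviates a universally quantified formula. *)
Fixpoint quantifier_free (f : formula) : bool :=
  match f with
  | Top | Bot | Eq _ _ => true
  | PEq _ _ _ => false
  | Not f => quantifier_free f
  | And f g | Or f g | Imp f g => quantifier_free f && quantifier_free g
  end.

Fixpoint tsize (t : term) : nat :=
  match t with
  | Var _ => 1
  | Rd t i => (tsize t + tsize i).+1
  | Wr t i v => (tsize t + tsize i + tsize v).+1
  end.

Fixpoint fsize (f : formula) : nat :=
  match f with
  | Top | Bot => 1
  | Eq t u => (tsize t + tsize u).+1
  | PEq t js u => (tsize t + sumn (map tsize js) + tsize u).+1
  | Not f => (fsize f).+1
  | And f g | Or f g | Imp f g => (fsize f + fsize g).+1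
  end.

Fixpoint subterms (t : term) : seq term :=
  t :: match t with
       | Var _ => [::]
       | Rd t i => subterms t ++ subterms i
       | Wr t i v => subterms t ++ subterms i ++ subterms v
       end.

Fixpoint terms (f : formula) : seq term :=
  match f with
  | Top | Bot => [::]
  | Eq t u => subterms t ++ subterms u
  | PEq t js u => subterms t ++ flatten (map subterms js) ++ subterms u
  | Not f => terms f
  | And f g | Or f g | Imp f g => terms f ++ terms g
  end.

Fixpoint atoms (f : formula) : seq formula :=
  match f with
  | Top | Bot => [::]
  | Eq _ _ | PEq _ _ _ => [:: f]
  | Not f => atoms f
  | And f g | Or f g | Imp f g => atoms f ++ atoms g
  end.

(* Replacement acts on every occurrence: when phi[r] denotes a formula in which
   r occurs, phi[s] is the formula in which s stands for r throughout. *)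
Fixpoint replt (r s t : term) : term :=
  if t == r then s else
  match t with
  | Var _ => t
  | Rd t i => Rd (replt r s t) (replt r s i)
  | Wr t i v => Wr (replt r s t) (replt r s i) (replt r s v)
  end.

Fixpoint repl (r s : term) (f : formula) : formula :=
  match f with
  | Top | Bot => f
  | Eq t u => Eq (replt r s t) (replt r s u)
  | PEq t js u => PEq (replt r s t) (map (replt r s) js) (replt r s u)
  | Not f => Not (repl r s f)
  | And f g => And (repl r s f) (repl r s g)
  | Or f g => Or (repl r s f) (repl r s g)
  | Imp f g => Imp (repl r s f) (repl r s g)
  end.

Fixpoint repl_atom (p q f : formula) : formula :=
  match f with
  | Top | Bot => f
  | Eq _ _ | PEq _ _ _ => if f == p then q else f
  | Not f => Not (repl_atom p q f)
  | And f g => And (repl_atom p q f) (repl_atom p q g)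
  | Or f g => Or (repl_atom p q f) (repl_atom p q g)
  | Imp f g => Imp (repl_atom p q f) (repl_atom p q g)
  end.

Definition is_wr (t : term) : bool := if t is Wr _ _ _ then true else false.

(* j \in js, as the disjunction of the equations j = js(k). *)
Definition mem_vec (j : term) (js : seq term) : formula :=
  foldr (fun i f => Or (Eq j i) f) Bot js.

Definition conjoin (fs : seq formula) : formula := foldr And Top fs.

(* Iterated write wr(t, js, vs). *)
Definition wr_vec (t : term) (js vs : seq term) : term :=
  foldl (fun u iv => Wr u iv.1 iv.2) t (zip js vs).

Definition val_sort (a : var) : asort := if a.1 is Arr _ V then V else a.1.

Definition free_of (a : var) (fs : seq formula) : bool :=
  all (fun f => Var a \notin terms f) fs.

Definition tfree_of (a : var) (t : term) : bool := Var a \notin subterms t.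

Fixpoint only_read_t (a : var) (t : term) : bool :=
  match t with
  | Var x => x != a
  | Rd t i => ((t == Var a) || only_read_t a t) && only_read_t a i
  | Wr t i v => [&& only_read_t a t, only_read_t a i & only_read_t a v]
  end.

Fixpoint only_read (a : var) (f : formula) : bool :=
  match f with
  | Top | Bot => true
  | Eq t u => only_read_t a t && only_read_t a u
  | PEq t js u => [&& only_read_t a t, all (only_read_t a) js & only_read_t a u]
  | Not f => only_read a f
  | And f g | Or f g | Imp f g => only_read a f && only_read a g
  end.

(* A sequence of disjuncts stands for their disjunction.  A rule whose right-hand
   side is a disjunction phi_1 \/ phi_2 replaces the rewritten disjunct by the
   sequence [:: phi_1; phi_2]; later rule applications take one of the resulting
   disjuncts as their formula phi. *)
Definition in_disjunct {T : Type} (rule : T -> seq T -> Prop) (ds ds' : seq T) : Prop :=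
  exists l d r es, [/\ ds = l ++ d :: r, rule d es & ds' = l ++ es ++ r].

Definition fixed_point {T : Type} (rule : T -> seq T -> Prop) (ds : seq T) : Prop :=
  ~ exists ds', in_disjunct rule ds ds'.

Inductive norm_rule : formula -> seq formula -> Prop :=
| ElimWrRd phi t i v j of Rd (Wr t i v) j \in terms phi :
    norm_rule phi
      [:: And (Eq i j) (repl (Rd (Wr t i v) j) v phi);
          And (Not (Eq i j)) (repl (Rd (Wr t i v) j) (Rd t j) phi)]
| ElimWrEq phi t1 j v js t2 of PEq (Wr t1 j v) js t2 \in atoms phi :
    norm_rule phi
      [:: And (mem_vec j js)
            (repl_atom (PEq (Wr t1 j v) js t2) (PEq t1 js t2) phi);
          And (Not (mem_vec j js))
            (repl_atom (PEq (Wr t1 j v) js t2)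
               (And (PEq t1 (rcons js j) t2) (Eq v (Rd t2 j))) phi)]
| PartialEq phi t1 t2 of Eq t1 t2 \in atoms phi & array_sorted t1 :
    norm_rule phi [:: repl_atom (Eq t1 t2) (PEq t1 [::] t2) phi]
| TrivEq phi t js of PEq t js t \in atoms phi :
    norm_rule phi [:: repl_atom (PEq t js t) Top phi]
| Symm phi t1 js t2 of PEq t1 js t2 \in atoms phi & is_wr t2 & ~~ is_wr t1 :
    norm_rule phi [:: repl_atom (PEq t1 js t2) (PEq t2 js t1) phi].

(* exists a ex, body /\ lits /\ rds.  [lits] holds the partial equalities on a that
   have been case split (or their negations) and [rds] the equations s = rd(a,t)
   introduced so far.  The splitting rule only looks at [body], and the factoring
   rule only at [body] and [lits]: each partial equality on a and each read term
   over a is thus treated exactly once. *)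
Record disjunct := Disjunct {
  ex : seq var;
  body : formula;
  lits : seq formula;
  rds : seq formula
}.

Definition fresh (a : var) (xs : seq var) (fs : seq formula) (x : var) : bool :=
  [&& x != a, x \notin xs & free_of x fs].

(* Partial equality being symmetric, both orientations count as being on a. *)
Inductive split_rule (a : var) : disjunct -> seq disjunct -> Prop :=
| CaseSplitEq xs phi ls rs p js t
    of p \in atoms phi
    & (p = PEq (Var a) js t) \/ (p = PEq t js (Var a)) :
    split_rule a (Disjunct xs phi ls rs)
      [:: Disjunct xs (repl_atom p Top phi) (rcons ls (PEq (Var a) js t)) rs;
          Disjunct xs (repl_atom p Bot phi) (rcons ls (Not (PEq (Var a) js t))) rs].

(* The index t must not itself mention a, so nested reads are factored from the
   inside out; it may read other arrays, as in rd(a, rd(b,x)). *)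
Inductive factor_rule (a : var) : disjunct -> seq disjunct -> Prop :=
| FactorRd xs phi ls rs t s
    of Rd (Var a) t \in flatten (map terms (phi :: ls))
    & tfree_of a t
    & s.1 = val_sort a
    & fresh a xs (phi :: ls ++ rs) s :
    factor_rule a (Disjunct xs phi ls rs)
      [:: Disjunct (rcons xs s)
            (repl (Rd (Var a) t) (Var s) phi)
            (map (repl (Rd (Var a) t) (Var s)) ls)
            (rcons rs (Eq (Var s) (Rd (Var a) t)))].

(* (xs, fs) stands for exists a xs, conjoin fs. *)
Definition clause : Type := (seq var * seq formula)%type.

Definition clause_of (d : disjunct) : clause :=
  (ex d, body d :: lits d ++ rds d).

(* [bool_rewrite f] is a disjunctive normal form of the outermost connective of f
   (up to one negation), as a disjunction of conjunctions; [None] on literals. *)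
Definition bool_rewrite (f : formula) : option (seq (seq formula)) :=
  match f with
  | Top | Not Bot => Some [:: [::]]
  | Bot | Not Top => Some [::]
  | And f g => Some [:: [:: f; g]]
  | Or f g => Some [:: [:: f]; [:: g]]
  | Imp f g => Some [:: [:: Not f]; [:: g]]
  | Not (Not f) => Some [:: [:: f]]
  | Not (And f g) => Some [:: [:: Not f]; [:: Not g]]
  | Not (Or f g) => Some [:: [:: Not f; Not g]]
  | Not (Imp f g) => Some [:: [:: f; Not g]]
  | _ => None
  end.

Inductive lift_rule : clause -> seq clause -> Prop :=
| Distribute xs fs f gs alts of bool_rewrite f = Some alts :
    lift_rule (xs, fs ++ f :: gs) [seq (xs, fs ++ alt ++ gs) | alt <- alts].

(* exists a d_ex, d_core /\ partial equalities a =_js t /\ their negations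
   /\ equations s = rd(a,t). *)
Record delta := Delta {
  d_ex : seq var;
  d_core : seq formula;
  d_eqs : seq (seq term * term);
  d_diseqs : seq (seq term * term);
  d_rds : seq (term * term)
}.

Definition eq_lits (a : var) (es : seq (seq term * term)) : seq formula :=
  [seq PEq (Var a) e.1 e.2 | e <- es].
Definition diseq_lits (a : var) (es : seq (seq term * term)) : seq formula :=
  [seq Not (PEq (Var a) e.1 e.2) | e <- es].
Definition rd_lits (a : var) (rs : seq (term * term)) : seq formula :=
  [seq Eq r.1 (Rd (Var a) r.2) | r <- rs].

Definition delta_conjs (a : var) (d : delta) : seq formula :=
  d_core d ++ eq_lits a (d_eqs d) ++ diseq_lits a (d_diseqs d) ++ rd_lits a (d_rds d).

(* Reordering of conjuncts, all the literals on a coming last. *)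
Definition lifted (a : var) (c : clause) (d : delta) : Prop :=
  [/\ d_ex d = c.1, perm_eq (delta_conjs a d) c.2 & free_of a (d_core d)].

(* A disjunct that is still to be treated, or an output exists xs, psi. *)
Definition pending : Type := (delta + (seq var * formula))%type.

Fixpoint ackermann (rs : seq (term * term)) : seq formula :=
  if rs is (s, t) :: rs' then
    [seq Imp (Eq t r.2) (Eq s r.1) | r <- rs'] ++ ackermann rs'
  else [::].

Inductive elim_rule (a : var) : pending -> seq pending -> Prop :=
| ElimEq xs cs es1 js t es2 ds rs vs
    of tfree_of a t
    & size vs = size js
    & uniq vs
    & all (fun x => x.1 == val_sort a) vs
    & all (fresh a xs (delta_conjs a (Delta xs cs (es1 ++ (js, t) :: es2) ds rs))) vs :
    elim_rule a (inl (Delta xs cs (es1 ++ (js, t) :: es2) ds rs))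
      [:: inr (xs ++ vs,
               repl (Var a) (wr_vec t js (map Var vs))
                 (conjoin (delta_conjs a (Delta xs cs (es1 ++ es2) ds rs))))]
| ElimDiseq xs cs d ds rs
    of all (fun e => tfree_of a e.2) (d :: ds)
    & all (only_read a) (cs ++ rd_lits a rs) :
    elim_rule a (inl (Delta xs cs [::] (d :: ds) rs))
      [:: inl (Delta xs cs [::] [::] rs)]
| Ackermann xs cs rs
    of free_of a cs
    & all (fun r => tfree_of a r.1 && tfree_of a r.2) rs :
    elim_rule a (inl (Delta xs cs [::] [::] rs))
      [:: inr (xs, conjoin (cs ++ ackermann rs))].

Inductive state :=
| Normalise of seq formula
| Split of seq disjunct
| Factor of seq disjunct
| Lift of seq clause
| Eliminate of seq pending
| Return of seq (seq var * formula).

Definition init (phi : formula) : state := Normalise [:: phi].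

Definition returned (s : state) : bool := if s is Return _ then true else false.

Inductive step (a : var) : state -> state -> Prop :=
| step_norm ds ds' of in_disjunct norm_rule ds ds' :
    step a (Normalise ds) (Normalise ds')
| end_norm ds of fixed_point norm_rule ds :
    step a (Normalise ds) (Split [seq Disjunct [::] phi [::] [::] | phi <- ds])
| step_split ds ds' of in_disjunct (split_rule a) ds ds' :
    step a (Split ds) (Split ds')
| end_split ds of fixed_point (split_rule a) ds :
    step a (Split ds) (Factor ds)
| step_factor ds ds' of in_disjunct (factor_rule a) ds ds' :
    step a (Factor ds) (Factor ds')
| end_factor ds of fixed_point (factor_rule a) ds :
    step a (Factor ds) (Lift (map clause_of ds))
| step_lift cs cs' of in_disjunct lift_rule cs cs' :
    step a (Lift cs) (Lift cs')
| end_lift cs (ds : seq delta) of List.Forall2 (lifted a) cs ds :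
    step a (Lift cs) (Eliminate (map inl ds))
| step_elim ps ps' of in_disjunct (elim_rule a) ps ps' :
    step a (Eliminate ps) (Eliminate ps')
| end_elim rs :
    step a (Eliminate (map inr rs)) (Return rs).

Definition fsizes (fs : seq formula) : nat := sumn (map fsize fs).

Definition disjunct_size (d : disjunct) : nat :=
  size (ex d) + fsize (body d) + fsizes (lits d) + fsizes (rds d).

Definition pending_size (a : var) (p : pending) : nat :=
  match p with
  | inl d => size (d_ex d) + fsizes (delta_conjs a d)
  | inr (xs, psi) => size xs + fsize psi
  end.

Definition state_size (a : var) (s : state) : nat :=
  match s with
  | Normalise ds => fsizes ds
  | Split ds | Factor ds => sumn (map disjunct_size ds)
  | Lift cs => sumn [seq size c.1 + fsizes c.2 | c <- cs]
  | Eliminate ps => sumn (map (pending_size a) ps)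
  | Return rs => sumn [seq size r.1 + fsize r.2 | r <- rs]
  end.

(* [exec a s n s']: some run leads from s to s' in time n, where a rule application
   is charged the number of symbols of the whole formula it reads and of the whole
   formula it writes, plus one. *)
Inductive exec (a : var) : state -> nat -> state -> Prop :=
| exec_refl s : exec a s 0 s
| exec_step s s' s'' n of step a s s' & exec a s' n s'' :
    exec a s (1 + state_size a s + state_size a s' + n) s''.

(* Whatever choices are made, no run takes more time than T, and a run can only
   stop by returning.  As every step costs at least 1, there is no infinite run. *)
Definition terminates_within (a : var) (phi : formula) (T : nat) : Prop :=
  forall n s, exec a (init phi) n s ->
    n <= T /\ (returned s \/ exists s', step a s s').

(* Main.v *)
(* The Boolean skeleton of a disjunct is followed through the four phases.  Only
   normalisation, case splitting and Boolean rewriting branch, and there every child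
   has a smaller potential which is polynomial at the start, so that each disjunct has
   exponentially many descendants; the size of a disjunct grows at most by a polynomial
   factor along one edge, hence stays exponential.  The potential for normalisation
   multiplies the ranks of the two sides of each array equation and adds the ranks of
   the distinct read terms: a write peeled off one side is charged once against the
   other side, which pays for the read it creates.  A run cannot get stuck because the
   normal forms of each phase leave the array variable only in the positions that the
   next phase eliminates. *)
From Stdlib Require Import Classical.
From mathcomp Require Import all_boot zify.
Require Import Defs.

Set Implicit Arguments.
Unset Strict Implicit.
Unset Printing Implicit Defensive.

Local Arguments array_sorted : simpl never.

Lemma leq_big_seq_mem (T : eqType) (F : T -> nat) (s : seq T) x :
  x \in s -> F x <= \sum_(y <- s) F y.
Proof. by move=> xs; rewrite (big_rem x xs) leq_addr. Qed.

Lemma leq_big_uniq_sub (T : eqType) (F : T -> nat) (s1 s2 : seq T) :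
  uniq s1 -> {subset s1 <= s2} -> \sum_(y <- s1) F y <= \sum_(y <- s2) F y.
Proof.
elim: s1 s2 => [|x s1 IH] s2 /=; first by rewrite big_nil.
case/andP=> xs1 us1 sub; have xs2 : x \in s2 by apply: sub; rewrite mem_head.
rewrite big_cons (big_rem x xs2) leq_add2l; apply: IH => // y ys1.
move: (sub y); rewrite inE ys1 orbT => /(_ isT).
rewrite (perm_mem (perm_to_rem xs2)) inE => /orP[/eqP yx|//].
by rewrite -yx ys1 in xs1.
Qed.

Lemma leq_sum_seq_in (T : eqType) (F G : T -> nat) (s : seq T) :
  {in s, forall x, F x <= G x} -> \sum_(x <- s) F x <= \sum_(x <- s) G x.
Proof.
by move=> FG; rewrite big_seq [X in _ <= X]big_seq; apply: leq_sum => x /FG.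
Qed.

Lemma ltn_sum_seq_in (T : eqType) (F G : T -> nat) (s : seq T) x d :
  x \in s -> F x + d <= G x -> {in s, forall y, F y <= G y} ->
  \sum_(y <- s) F y + d <= \sum_(y <- s) G y.
Proof.
move=> xs lt_x FG; rewrite (big_rem x xs) [X in _ <= X](big_rem x xs) /= addnAC.
by apply: leq_add => //; apply: leq_sum_seq_in => y /mem_rem/FG.
Qed.

(** * Formulas as Boolean skeletons over their atoms *)

Fixpoint nconn (f : formula) : nat :=
  match f with
  | Top | Bot => 1
  | Eq _ _ | PEq _ _ _ => 0
  | Not f => (nconn f).+1
  | And f g | Or f g | Imp f g => (nconn f + nconn g).+1
  end.

Definition weight (F : formula -> nat) (f : formula) : nat :=
  nconn f + \sum_(p <- atoms f) F p.

Lemma atoms_repl r s f : atoms (repl r s f) = map (repl r s) (atoms f).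
Proof. by elim: f => //= f -> g ->; rewrite map_cat. Qed.

Lemma atoms_repl_atom p q f :
  atoms (repl_atom p q f) =
  flatten [seq if x == p then atoms q else [:: x] | x <- atoms f].
Proof.
elim: f => //= [t u|t js u|f -> g ->|f -> g ->|f -> g ->];
  rewrite ?map_cat ?flatten_cat // cats0; by case: ifP.
Qed.

Lemma nconn_repl r s f : nconn (repl r s f) = nconn f.
Proof. by elim: f => //= [f ->|f -> g ->|f -> g ->|f -> g ->]. Qed.

Lemma nconn_repl_atom p q f :
  nconn (repl_atom p q f) = nconn f + count_mem p (atoms f) * nconn q.
Proof.
elim: f => //= [t u|t js u|f ->|f -> g ->|f -> g ->|f -> g ->];
  rewrite ?count_cat; try case: ifP; move=> //=; lia.
Qed.

Lemma weight_repl F r s f :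
  weight F (repl r s f) = nconn f + \sum_(p <- atoms f) F (repl r s p).
Proof. by rewrite /weight nconn_repl atoms_repl big_map. Qed.

Lemma weight_repl_atom F p q f :
  weight F (repl_atom p q f) =
  nconn f + \sum_(x <- atoms f) (if x == p then weight F q else F x).
Proof.
rewrite /weight nconn_repl_atom atoms_repl_atom big_flatten big_map -addnA.
congr (_ + _); elim: (atoms f) => [|x s IH]; first by rewrite !big_nil.
rewrite !big_cons -IH /=; case: eqP => _ /=; first by rewrite mulnDl; lia.
rewrite big_seq1; lia.
Qed.

Lemma weight_repl_atom_lt F p q f d :
  p \in atoms f -> weight F q + d <= F p ->
  weight F (repl_atom p q f) + d <= weight F f.
Proof.
move=> pf le_qp; rewrite weight_repl_atom /weight -addnA leq_add2l.
apply: (ltn_sum_seq_in pf) => [|x _]; first by rewrite eqxx.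
by case: eqP => [->|//]; apply: leq_trans le_qp; apply: leq_addr.
Qed.

Lemma fsizeE f : fsize f = weight fsize f.
Proof.
rewrite /weight; elim: f => /= [||t u|t js u|f ->|f -> g ->|f -> g ->|f -> g ->];
  rewrite ?big_nil ?big_seq1 ?big_cat //=; lia.
Qed.

Lemma termsE f : terms f = flatten (map terms (atoms f)).
Proof.
by elim: f => //= [t u|t js u|f -> g ->|f -> g ->|f -> g ->];
  rewrite ?cats0 ?map_cat ?flatten_cat.
Qed.

Lemma mem_terms p f t : p \in atoms f -> t \in terms p -> t \in terms f.
Proof.
by move=> pf tp; rewrite termsE; apply/flatten_mapP; exists p.
Qed.

Lemma well_sortedE f : well_sorted f = all well_sorted (atoms f).
Proof.
by elim: f => //= [t u|t js u|f -> g ->|f -> g ->|f -> g ->];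
  rewrite ?andbT ?all_cat.
Qed.

Lemma only_readE a f : only_read a f = all (only_read a) (atoms f).
Proof.
by elim: f => //= [t u|t js u|f -> g ->|f -> g ->|f -> g ->];
  rewrite ?andbT ?all_cat.
Qed.

Lemma fsize_atom p f : p \in atoms f -> fsize p <= fsize f.
Proof.
move=> pf; rewrite [fsize f]fsizeE /weight.
by apply: leq_trans (leq_addl _ _); apply: leq_big_seq_mem.
Qed.

Lemma fsize_gt0 f : 0 < fsize f. Proof. by case: f. Qed.
Lemma tsize_gt0 t : 0 < tsize t. Proof. by case: t. Qed.

Lemma fsize_repl_atom c p q f :
  0 < c -> fsize q <= c * fsize p -> fsize (repl_atom p q f) <= c * fsize f.
Proof.
move=> c0 qp; elim: f => [||t u|t js u|f IH|f IHf g IHg|f IHf g IHg|f IHf g IHg];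
  try (by rewrite leq_pmull);
  try (by rewrite [repl_atom _ _ _]/=; case: eqP => [->|_] //; rewrite leq_pmull).
all: rewrite /= mulnS ?mulnDr; lia.
Qed.

(** * Subterms and replacement *)

Lemma subterms_refl t : t \in subterms t.
Proof. by case: t => *; rewrite /= mem_head. Qed.

Lemma subterms_trans t u v :
  t \in subterms u -> u \in subterms v -> t \in subterms v.
Proof.
move=> tu; elim: v => [x|v1 IH1 v2 IH2|v1 IH1 v2 IH2 v3 IH3] /=;
  rewrite !inE ?mem_cat.
- by move/eqP=> uE; rewrite uE /= inE in tu.
- case/orP=> [/eqP uE|]; first by rewrite uE /= inE mem_cat in tu.
  by case/orP=> [/IH1|/IH2] ->; rewrite ?orbT.
- case/orP=> [/eqP uE|]; first by rewrite uE /= inE !mem_cat in tu.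
  by case/or3P=> [/IH1|/IH2|/IH3] ->; rewrite ?orbT.
Qed.

Lemma terms_sub f t u : u \in terms f -> t \in subterms u -> t \in terms f.
Proof.
move=> + tu; elim: f => //= [v w|v js w|f IHf g IHg|f IHf g IHg|f IHf g IHg];
  rewrite ?mem_cat.
- by case/orP=> /(subterms_trans tu) ->; rewrite ?orbT.
- case/or3P=> [/(subterms_trans tu) ->||/(subterms_trans tu) ->]; rewrite ?orbT //.
  case/flatten_mapP=> j jjs /(subterms_trans tu) tj.
  by apply/orP; right; apply/orP; left; apply/flatten_mapP; exists j.
- by case/orP=> [/IHf|/IHg] ->; rewrite ?orbT.
- by case/orP=> [/IHf|/IHg] ->; rewrite ?orbT.
- by case/orP=> [/IHf|/IHg] ->; rewrite ?orbT.
Qed.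

Lemma leq_tsize_subterms t u : t \in subterms u -> tsize t <= tsize u.
Proof.
elim: u => [x|u1 IH1 u2 IH2|u1 IH1 u2 IH2 u3 IH3] /=; rewrite !inE ?mem_cat.
- by move/eqP->.
- by case/orP=> [/eqP-> //|/orP[/IH1|/IH2]]; lia.
- by case/orP=> [/eqP-> //|/or3P[/IH1|/IH2|/IH3]]; lia.
Qed.

Lemma leq_tsize_sumn j js : j \in js -> tsize j <= sumn (map tsize js).
Proof. by rewrite sumnE big_map => /(leq_big_seq_mem tsize). Qed.

Lemma leq_tsize_terms t f : t \in terms f -> tsize t <= fsize f.
Proof.
elim: f => //= [v w|v js w|f IHf|f IHf g IHg|f IHf g IHg|f IHf g IHg];
  rewrite ?mem_cat.
- by case/orP=> /leq_tsize_subterms; lia.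
- case/or3P=> [/leq_tsize_subterms||/leq_tsize_subterms]; [lia| |lia].
  by case/flatten_mapP=> j /leq_tsize_sumn + /leq_tsize_subterms; lia.
- by move/IHf; lia.
- by case/orP=> [/IHf|/IHg]; lia.
- by case/orP=> [/IHf|/IHg]; lia.
- by case/orP=> [/IHf|/IHg]; lia.
Qed.

Lemma replt_refl r s : replt r s r = s.
Proof. by case: r => * /=; rewrite eqxx. Qed.

Lemma replt_id r s t : r \notin subterms t -> replt r s t = t.
Proof.
elim: t => [x|t1 IH1 t2 IH2|t1 IH1 t2 IH2 t3 IH3] /=;
  rewrite !inE ?mem_cat ?negb_or eq_sym.
- by move/negbTE->.
- by case/and3P=> /negbTE-> /IH1-> /IH2->.
- by case/and4P=> /negbTE-> /IH1-> /IH2-> /IH3->.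
Qed.

Lemma replt_small r s t : tsize t < tsize r -> replt r s t = t.
Proof.
move=> lt_tr; apply: replt_id; apply/negP=> /leq_tsize_subterms; lia.
Qed.

Lemma subterms_replt r s t u :
  u \in subterms (replt r s t) ->
  u \in subterms s \/ u \in map (replt r s) (subterms t).
Proof.
elim: t => [x|t1 IH1 t2 IH2|t1 IH1 t2 IH2 t3 IH3] /=.
- by case: eqP => _; [left|right].
- case: eqP => _; first by left.
  rewrite /= inE mem_cat map_cat => /or3P[/eqP->|/IH1|/IH2].
  + by right; rewrite mem_head.
  + by case=> [|um]; [left|right]; rewrite // inE mem_cat um ?orbT.
  + by case=> [|um]; [left|right]; rewrite // inE mem_cat um ?orbT.
- case: eqP => _; first by left.
  rewrite /= inE !mem_cat !map_cat => /or4P[/eqP->|/IH1|/IH2|/IH3].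
  + by right; rewrite mem_head.
  + by case=> [|um]; [left|right]; rewrite // inE !mem_cat um ?orbT.
  + by case=> [|um]; [left|right]; rewrite // inE !mem_cat um ?orbT.
  + by case=> [|um]; [left|right]; rewrite // inE !mem_cat um ?orbT.
Qed.

Lemma terms_repl r s f u :
  u \in terms (repl r s f) ->
  u \in subterms s \/ u \in map (replt r s) (terms f).
Proof.
elim: f => //= [v w|v js w|f IHf g IHg|f IHf g IHg|f IHf g IHg];
  rewrite ?map_cat ?mem_cat.
- by case/orP=> /subterms_replt [] ->; rewrite ?orbT; auto.
- case/or3P=> [/subterms_replt [] ->||/subterms_replt [] ->]; rewrite ?orbT; auto.
  case/flatten_mapP=> _ /mapP[j jjs ->] /subterms_replt [|/mapP[t tj ->]]; first by left.
  right; apply/orP; right; apply/orP; left; apply: map_f.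
  by apply/flatten_mapP; exists j.
- by case/orP=> [/IHf|/IHg] [] ->; rewrite ?orbT; auto.
- by case/orP=> [/IHf|/IHg] [] ->; rewrite ?orbT; auto.
- by case/orP=> [/IHf|/IHg] [] ->; rewrite ?orbT; auto.
Qed.

Lemma leq_tsize_replt r s t :
  tsize s <= tsize r ->
  tsize (replt r s t) + (r \in subterms t) * (tsize r - tsize s) <= tsize t.
Proof.
move=> le_sr.
have base : tsize (replt r s r) + (r \in subterms r) * (tsize r - tsize s) <= tsize r.
  by rewrite replt_refl subterms_refl mul1n subnKC.
elim: t => [x|t1 IH1 t2 IH2|t1 IH1 t2 IH2 t3 IH3].
- have [-> //|ne] := eqVneq (Var x) r.
  by rewrite /= (negbTE ne) inE eq_sym (negbTE ne).
- have [-> //|ne] := eqVneq (Rd t1 t2) r.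
  rewrite /= (negbTE ne) inE eq_sym (negbTE ne) mem_cat /=.
  by case: (r \in subterms t1) IH1 => IH1; case: (r \in subterms t2) IH2 => IH2 /=; lia.
- have [-> //|ne] := eqVneq (Wr t1 t2 t3) r.
  rewrite /= (negbTE ne) inE eq_sym (negbTE ne) !mem_cat /=.
  by case: (r \in subterms t1) IH1 => IH1; case: (r \in subterms t2) IH2 => IH2;
    case: (r \in subterms t3) IH3 => IH3 /=; lia.
Qed.

Lemma leq_fsize_repl r s f :
  tsize s <= tsize r ->
  fsize (repl r s f) + (r \in terms f) * (tsize r - tsize s) <= fsize f.
Proof.
move=> le_sr; have leT t := leq_tsize_replt t le_sr.
elim: f => //= [v w|v js w|f IHf g IHg|f IHf g IHg|f IHf g IHg];
  rewrite ?mem_cat.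
- have := leT v; have := leT w.
  by case: (r \in subterms v); case: (r \in subterms w) => /=; lia.
- have le_js : sumn (map tsize (map (replt r s) js)) +
      (r \in flatten (map subterms js)) * (tsize r - tsize s) <= sumn (map tsize js).
    elim: js => //= j js IH; rewrite mem_cat; have := leT j.
    by case: (r \in subterms j); case: (r \in flatten _) IH => /=; lia.
  have := leT v; have := leT w; move: le_js.
  by case: (r \in subterms v); case: (r \in subterms w);
    case: (r \in flatten _) => /=; lia.
- by case: (r \in terms f) IHf; case: (r \in terms g) IHg => /=; lia.
- by case: (r \in terms f) IHf; case: (r \in terms g) IHg => /=; lia.
- by case: (r \in terms f) IHf; case: (r \in terms g) IHg => /=; lia.
Qed.

Lemma fsize_repl_mul r s f : fsize (repl r s f) <= fsize f * tsize s.
Proof.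
have s0 := tsize_gt0 s.
have leT t : tsize (replt r s t) <= tsize t * tsize s.
  elim: t => [x|t1 IH1 t2 IH2|t1 IH1 t2 IH2 t3 IH3] /=; case: eqP => _ /=; nia.
elim: f => /= [||v w|v js w|f IHf|f IHf g IHg|f IHf g IHg|f IHf g IHg]; try nia.
- have := leT v; have := leT w; nia.
- have le_js : sumn (map tsize (map (replt r s) js)) <= sumn (map tsize js) * tsize s.
    elim: js => //= j js IH; have := leT j; nia.
  have := leT v; have := leT w; nia.
Qed.

Lemma sort_replt r s t :
  sort_of s = sort_of r -> sort_of (replt r s t) = sort_of t.
Proof.
move=> sE; elim: t => [x|t1 IH1 t2 IH2|t1 IH1 t2 IH2 t3 IH3] /=;
  by case: eqP => [rE|_] /=; rewrite ?IH1 ?IH2 ?IH3 // sE -rE.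
Qed.

Lemma well_sorted_repl r s f :
  sort_of s = sort_of r -> well_sorted (repl r s f) = well_sorted f.
Proof.
move=> sE; elim: f => //= [t u|t js u|f -> g ->|f -> g ->|f -> g ->] //.
- by rewrite !sort_replt.
- rewrite !sort_replt //; case: (sort_of t) => [[//|J V]|//].
  by rewrite all_map; congr (_ && _); apply: eq_all => j /=; rewrite sort_replt.
Qed.

Lemma sorted_subterms t u :
  isSome (sort_of u) -> t \in subterms u -> isSome (sort_of t).
Proof.
elim: u => [x|u1 IH1 u2 IH2|u1 IH1 u2 IH2 u3 IH3] /=; rewrite !inE ?mem_cat.
- by move=> _ /eqP->.
- case E1: (sort_of u1) => [[//|J V]|//]; case: eqP => // E2 _.
  case/or3P=> [/eqP->|/IH1->|/IH2->] //=; first by rewrite E1 E2 eqxx.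
    by rewrite E1.
  by rewrite E2.
- case E1: (sort_of u1) => [[//|J V]|//]; case: andP => // -[/eqP E2 /eqP E3] _.
  case/or4P=> [/eqP->|/IH1->|/IH2->|/IH3->] //=; first by rewrite E1 E2 E3 !eqxx.
  + by rewrite E1.
  + by rewrite E2.
  + by rewrite E3.
Qed.

Lemma sorted_terms f t : well_sorted f -> t \in terms f -> isSome (sort_of t).
Proof.
elim: f => //= [v w|v js w|f IHf g IHg|f IHf g IHg|f IHf g IHg];
  rewrite ?mem_cat.
- case/andP=> sv /eqP vw /orP[] /sorted_subterms -> //; by rewrite -vw.
- case E: (sort_of v) => [[//|J V]|//] /andP[/eqP vw /allP sjs].
  case/or3P=> [/sorted_subterms->||/sorted_subterms->] //; first by rewrite E.
    by case/flatten_mapP=> j /sjs /eqP jE /sorted_subterms->; rewrite ?jE.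
  by rewrite -vw.
- by case/andP=> [wf wg] /orP[/IHf|/IHg]; apply.
- by case/andP=> [wf wg] /orP[/IHf|/IHg]; apply.
- by case/andP=> [wf wg] /orP[/IHf|/IHg]; apply.
Qed.

(** * Normalisation *)

(* Reads are free and indices are ignored, so that [wrank] never increases under
   read-over-write, while a write costs more than the two terms it is split into. *)
Fixpoint wrank (t : term) : nat :=
  match t with
  | Var _ => 1
  | Rd t _ => wrank t
  | Wr t _ v => (wrank t + wrank v).+1
  end.

Definition rdrank (t : term) : nat := if t is Rd u _ then wrank u else 0.

(* Replacement acts on all occurrences at once, hence the sum over distinct terms. *)
Definition rdsum (f : formula) : nat := \sum_(t <- undup (terms f)) rdrank t.

(* Splitting the write in [Wr t1 j v =_js t2] frees 5 * K * wrank t2, which pays for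
   the new read [Rd t2 j], for the rules (PartialEq) and (Symm) on the new atoms and
   for the membership test in js. *)
Definition apot (K : nat) (p : formula) : nat :=
  match p with
  | Eq t u => 1 + array_sorted t * (2 * K + 5 * K * (wrank t * wrank u))
  | PEq t js u => 1 + (is_wr u && ~~ is_wr t) * K + 5 * K * (wrank t * wrank u)
  | _ => 0
  end.

Definition npot (K : nat) (f : formula) : nat := weight (apot K) f + K * rdsum f.

Definition short (n : nat) (p : formula) : bool :=
  match p with
  | Eq t u => array_sorted t ==> (wrank t + wrank u <= n)
  | PEq t js u => size js + wrank t + wrank u <= n
  | _ => true
  end.

Lemma wrank_gt0 t : 0 < wrank t. Proof. by elim: t. Qed.

Lemma wrank_tsize t : wrank t <= tsize t.
Proof. elim: t => //= *; lia. Qed.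

Lemma rdrank_wrank t : rdrank t <= wrank t.
Proof. by case: t. Qed.

Lemma wrank_replt r s t : wrank s <= wrank r -> wrank (replt r s t) <= wrank t.
Proof.
move=> le_sr; elim: t => [x|t1 IH1 t2 IH2|t1 IH1 t2 IH2 t3 IH3].
- by have [->|ne] := eqVneq (Var x) r; [rewrite replt_refl|rewrite /= (negbTE ne)].
- by have [->|ne] := eqVneq (Rd t1 t2) r; [rewrite replt_refl|rewrite /= (negbTE ne)].
- have [->|ne] := eqVneq (Wr t1 t2 t3) r; [by rewrite replt_refl|].
  rewrite /= (negbTE ne) /=; lia.
Qed.

Lemma rdsum_sub f g : {subset terms g <= terms f} -> rdsum g <= rdsum f.
Proof.
move=> sub; apply: leq_big_uniq_sub; first exact: undup_uniq.
by move=> t; rewrite !mem_undup => /sub.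
Qed.

Lemma rdsum_cons f g u :
  {subset terms g <= u :: terms f} -> rdsum g <= rdrank u + rdsum f.
Proof.
move=> sub; apply: (@leq_trans (\sum_(t <- u :: undup (terms f)) rdrank t));
  last by rewrite big_cons.
apply: leq_big_uniq_sub; first exact: undup_uniq.
by move=> t; rewrite mem_undup => /sub; rewrite !inE mem_undup.
Qed.

Section ReadOverWrite.
Variables (t i v j s : term).
Let r := Rd (Wr t i v) j.
Hypothesis sE : s = v \/ s = Rd t j.

Lemma tsize_rw : tsize s < tsize r.
Proof. by case: sE => -> /=; lia. Qed.

Lemma wrank_rw : wrank s < wrank r.
Proof. by case: sE => -> /=; lia. Qed.

Lemma sort_rw : isSome (sort_of r) ->
  sort_of s = sort_of r /\ sort_of i = sort_of j /\ array_sorted i = false /\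
  isSome (sort_of i).
Proof.
rewrite /r /array_sorted /=; case Et: (sort_of t) => [[//|J V]|//].
case: eqP => //= Ei; case: eqP => //= Ev; case: eqP => //= Ej _.
by rewrite Ei Ej; case: sE => ->; rewrite /= ?Et ?Ev ?Ej ?eqxx.
Qed.

Lemma rdsum_rw f g :
  r \in terms f ->
  (forall u, u \in terms g ->
     u \in terms (repl r s f) \/ u \in subterms i \/ u \in subterms j) ->
  rdsum g < rdsum f.
Proof.
move=> rf sub; rewrite -addn1.
have sub_r u : u \in subterms r -> tsize u < tsize r ->
    u \in map (replt r s) (undup (terms f)).
  move=> ur lt_ur; rewrite -[u](@replt_small r s) //; apply: map_f.
  by rewrite mem_undup; apply: terms_sub rf ur.
have sub_s u : u \in subterms s -> u \in map (replt r s) (undup (terms f)).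
  move=> us; have lt_ur := leq_ltn_trans (leq_tsize_subterms us) tsize_rw.
  case: sE => sE'.
    by apply: sub_r => //; rewrite /r /= !(inE, mem_cat) -sE' us !orbT.
  have [->|ne_us] := eqVneq u s.
    by rewrite -[X in X \in _](replt_refl r s) map_f // mem_undup.
  apply: sub_r => //; move: us; rewrite sE' /= inE -{1}sE' (negbTE ne_us) /=.
  by rewrite /r /= !(inE, mem_cat) => /orP[] ->; rewrite !orbT.
have le_g : rdsum g <= \sum_(u <- map (replt r s) (undup (terms f))) rdrank u.
  apply: leq_big_uniq_sub; first exact: undup_uniq.
  move=> u; rewrite mem_undup => /sub[/terms_repl[/sub_s //|/mapP[x xf ->]]|[ui|uj]].
  - by rewrite map_f // mem_undup.
  - apply: sub_r; first by rewrite /r /= !(inE, mem_cat) ui !orbT.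
    by have := leq_tsize_subterms ui; rewrite /=; lia.
  - apply: sub_r; first by rewrite /r /= !(inE, mem_cat) uj !orbT.
    by have := leq_tsize_subterms uj; rewrite /=; lia.
apply: leq_trans (leq_add le_g (leqnn 1)) _; rewrite big_map.
apply: (@ltn_sum_seq_in _ _ _ _ r); rewrite ?mem_undup //.
  rewrite replt_refl addn1; apply: leq_ltn_trans (rdrank_wrank s) wrank_rw.
move=> u _; have [->|ne] := eqVneq u r.
  rewrite replt_refl; apply: leq_trans (rdrank_wrank s) (ltnW wrank_rw).
case: u ne => [x|u1 u2|u1 u2 u3] ne; rewrite /= ?(negbTE ne) //=.
exact: wrank_replt (ltnW wrank_rw).
Qed.

Lemma apot_rw K p : isSome (sort_of r) -> well_sorted p ->
  apot K (repl r s p) <= apot K p.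
Proof.
move=> sr wp; have [srE _] := sort_rw sr.
have leW u := wrank_replt u (ltnW wrank_rw).
case: p wp => //= [u w|u js w] wp.
  rewrite /array_sorted sort_replt //; case: (sort_of u) => [[//|J V]|//].
  by rewrite !mul1n leq_add2l leq_add2l leq_mul2l leq_mul ?orbT.
have is_wr_mono x : is_wr x -> is_wr (replt r s x) by case: x.
have is_wr_lt x : is_wr (replt r s x) -> ~~ is_wr x -> wrank (replt r s x) < wrank x.
  have [->|ne] := eqVneq x r; first by rewrite replt_refl wrank_rw.
  by case: x ne => [x|x1 x2|x1 x2 x3] ne; rewrite /= ?(negbTE ne).
have := leW u; have := leW w; have := is_wr_mono u; have := is_wr_lt w.
have := wrank_gt0 (replt r s u).
move: (wrank (replt r s u)) (wrank (replt r s w)) => a b.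
case: (is_wr w); case: (is_wr u); case: (is_wr (replt r s w));
  case: (is_wr (replt r s u)) => //= a0; try (by move=> _ /(_ isT)).
all: move=> blt _ leb lea; rewrite ?mul0n ?mul1n ?addn0;
  try (by rewrite ?leq_add2l ?leq_mul2l ?leq_mul ?orbT);
  try (by rewrite -addnA leq_add2l; apply: leq_trans (leq_addl _ _);
    rewrite leq_mul2l leq_mul ?orbT).
all: try (have {}blt := blt isT isT); have := leq_mul lea blt;
 rewrite mulnS => /(leq_mul (leqnn (5 * K))); nia.
Qed.

End ReadOverWrite.

Lemma atoms_mem_vec j js : atoms (mem_vec j js) = map (Eq j) js.
Proof. by elim: js => //= i js ->. Qed.

Lemma nconn_mem_vec j js : nconn (mem_vec j js) = (size js).+1.
Proof. by elim: js => //= i js ->. Qed.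

Lemma fsize_mem_vec j js :
  fsize (mem_vec j js) = (size js * (tsize j + 2) + sumn (map tsize js)).+1.
Proof. by elim: js => //= i js ->; rewrite mulSn; lia. Qed.

Lemma terms_mem_vec j js u :
  u \in terms (mem_vec j js) -> u \in subterms j \/ u \in flatten (map subterms js).
Proof.
elim: js => //= i js IH; rewrite !mem_cat => /orP[/orP[->|->]|/IH[->|->]];
  by rewrite ?orbT; auto.
Qed.

Lemma terms_repl_atom p q f u :
  u \in terms (repl_atom p q f) -> u \in terms q \/ u \in terms f.
Proof.
elim: f => [||t w|t js w|f IHf|f IHf g IHg|f IHf g IHg|f IHf g IHg];
  rewrite [repl_atom _ _ _]/=; try by auto.
- by case: eqP; auto.
- by case: eqP; auto.
all: by rewrite /= !mem_cat => /orP[/IHf|/IHg] [] ->; rewrite ?orbT; auto.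
Qed.

Definition norm_ok (n : nat) (f : formula) : bool :=
  well_sorted f && all (short n) (atoms f).

Lemma norm_ok_and n f g : norm_ok n (And f g) = norm_ok n f && norm_ok n g.
Proof. by rewrite /norm_ok /= all_cat andbACA. Qed.

Lemma norm_ok_not n f : norm_ok n (Not f) = norm_ok n f.
Proof. by []. Qed.

Lemma weight_and F f g : weight F (And f g) = (weight F f + weight F g).+1.
Proof. by rewrite /weight /= big_cat /=; lia. Qed.

Lemma weight_not F f : weight F (Not f) = (weight F f).+1.
Proof. by []. Qed.

Lemma norm_ok_atom n p f : p \in atoms f -> norm_ok n f -> well_sorted p /\ short n p.
Proof.
by move=> pf; rewrite /norm_ok well_sortedE => /andP[/allP /(_ p pf) ? /allP /(_ p pf) ?].
Qed.

Lemma norm_ok_repl_atom n p q f :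
  norm_ok n f -> norm_ok n q -> norm_ok n (repl_atom p q f).
Proof.
rewrite /norm_ok !well_sortedE !atoms_repl_atom -!all_predI.
move=> /allP okf okq; apply/allP=> x /flatten_mapP[y yf].
by case: eqP => _; [move: x; apply/allP|rewrite inE => /eqP->; apply: okf].
Qed.

Lemma norm_ok_basic n i j :
  sort_of i = sort_of j -> isSome (sort_of i) -> array_sorted i = false ->
  norm_ok n (Eq i j).
Proof. by move=> ij si ai; rewrite /norm_ok /= -ij si eqxx ai. Qed.

Lemma short_repl n r s p : wrank s <= wrank r -> sort_of s = sort_of r ->
  short n p -> short n (repl r s p).
Proof.
move=> le_sr sE; case: p => //= [t u|t js u].
  rewrite /array_sorted sort_replt //.
  case: (sort_of t) => [[//|J V]|//] /=.
  by have := wrank_replt t le_sr; have := wrank_replt u le_sr; lia.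
rewrite size_map.
by have := wrank_replt t le_sr; have := wrank_replt u le_sr; lia.
Qed.

Definition norm_step (n : nat) (f g : formula) : Prop :=
  [/\ norm_ok n g, npot (2 * n + 10) g < npot (2 * n + 10) f
    & fsize g <= (n + 5) * fsize f].

Lemma norm_step_rw n f t i v j s e :
  s = v \/ s = Rd t j ->
  Rd (Wr t i v) j \in terms f -> norm_ok n f ->
  e = Eq i j \/ e = Not (Eq i j) ->
  norm_step n f (And e (repl (Rd (Wr t i v) j) s f)).
Proof.
set r := Rd (Wr t i v) j => sE rf okf eE.
have [wf /allP shf] := andP okf.
have sr := sorted_terms wf rf; have [srE [ij [ai si]]] := sort_rw sE sr.
have lew := wrank_rw i sE; have let_ := tsize_rw i sE.
have oke : norm_ok n e by case: eE => ->; rewrite ?norm_ok_not norm_ok_basic.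
have we : weight (apot (2 * n + 10)) e <= 2.
  by case: eE => ->; rewrite /weight /= big_seq1 /= ai.
have lt_rd : rdsum (And e (repl r s f)) < rdsum f.
  apply: (rdsum_rw sE rf) => u; rewrite /= mem_cat => /orP[ue|]; last by left.
  have : u \in subterms i ++ subterms j by case: eE ue => ->.
  by rewrite mem_cat => /orP[]; auto.
split.
- rewrite norm_ok_and oke /norm_ok well_sorted_repl // wf atoms_repl all_map /=.
  by apply/allP=> p /shf /=; apply: short_repl => //; apply: ltnW.
- have le_w : weight (apot (2 * n + 10)) (repl r s f) <= weight (apot (2 * n + 10)) f.
    rewrite weight_repl /weight leq_add2l; apply: leq_sum_seq_in => p pf.
    by apply: apot_rw => //; have [] := norm_ok_atom pf okf.
  by rewrite /npot weight_and; nia.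
- have := leq_fsize_repl f (ltnW let_); have := leq_tsize_terms rf.
  have : fsize e <= tsize i + tsize j + 2 by case: eE => -> /=; lia.
  by rewrite /r /=; have := fsize_gt0 f; nia.
Qed.

Lemma norm_step_repl_atom n f p q c d :
  p \in atoms f -> norm_ok n f -> norm_ok n q ->
  0 < c <= n + 5 -> fsize q <= c * fsize p ->
  rdsum (repl_atom p q f) <= d + rdsum f ->
  weight (apot (2 * n + 10)) q + (2 * n + 10) * d < apot (2 * n + 10) p ->
  norm_step n f (repl_atom p q f).
Proof.
set K := 2 * n + 10 => pf okf okq /andP[c0 cn] szq rdq potq.
split; first exact: norm_ok_repl_atom.
- have : weight (apot K) (repl_atom p q f) + (K * d + 1) <= weight (apot K) f.
    by apply: weight_repl_atom_lt => //; lia.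
  by have := leq_mul (leqnn K) rdq; rewrite /npot -/K; lia.
- by have := fsize_repl_atom f c0 szq; have := leq_mul cn (leqnn (fsize f)); lia.
Qed.

Lemma norm_step_memb n f p q j js e d :
  p \in atoms f -> norm_ok n f -> norm_ok n q ->
  size js <= n -> norm_ok n (mem_vec j js) ->
  all (fun i => sort_of j == sort_of i) js -> array_sorted j = false ->
  tsize j + 2 + sumn (map tsize js) <= fsize p ->
  {subset subterms j <= terms f} -> {subset flatten (map subterms js) <= terms f} ->
  e = mem_vec j js \/ e = Not (mem_vec j js) ->
  fsize q <= 2 * fsize p ->
  (forall g, {subset terms g <= terms q ++ terms f} -> rdsum g <= d + rdsum f) ->
  weight (apot (2 * n + 10)) q + (2 * n + 10) * d + (2 * n + 5) <= apot (2 * n + 10) p ->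
  norm_step n f (And e (repl_atom p q f)).
Proof.
set K := 2 * n + 10 => pf okf okq js_n okm sjs aj szp subj subjs eE szq rdq potq.
have we : weight (apot K) e <= 2 * n + 2.
  have wm : weight (apot K) (mem_vec j js) = 2 * size js + 1.
    rewrite /weight nconn_mem_vec atoms_mem_vec big_map.
    rewrite (eq_bigr (fun=> 1)); first by rewrite sum1_size; lia.
    by move=> i _ /=; rewrite aj.
  by case: eE => ->; rewrite ?weight_not wm; lia.
have sze : fsize e <= (n + 2) * fsize p.
  have szm : fsize (mem_vec j js) <= (n + 1) * fsize p.
    rewrite fsize_mem_vec; apply: (@leq_trans (n * (tsize j + 2) + fsize p)).
      by have := leq_mul js_n (leqnn (tsize j + 2)); lia.
    have /(leq_mul (leqnn n)) : tsize j + 2 <= fsize p by lia.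
    by lia.
  by case: eE => ->; rewrite /=; lia.
have oke : norm_ok n e by case: eE => ->.
split; first by rewrite norm_ok_and oke norm_ok_repl_atom.
- have : weight (apot K) (repl_atom p q f) + (K * d + (2 * n + 5)) <= weight (apot K) f.
    by apply: weight_repl_atom_lt => //; lia.
  have : rdsum (And e (repl_atom p q f)) <= d + rdsum f.
    apply: rdq => u; rewrite /= !mem_cat => /orP[ue|/terms_repl_atom[]->]; rewrite ?orbT //.
    have : u \in terms (mem_vec j js) by case: eE ue => ->.
    by case/terms_mem_vec=> [/subj|/subjs]->; rewrite orbT.
  move/(leq_mul (leqnn K)); rewrite /npot -/K weight_and; lia.
- have := fsize_repl_atom f (isT : 0 < 2) szq.
  have := leq_mul (leqnn (n + 2)) (fsize_atom pf); have := fsize_gt0 f.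
  rewrite /=; lia.
Qed.

Lemma norm_rule_step n f es :
  norm_rule f es -> norm_ok n f ->
  size es <= 2 /\ {in es, forall g, norm_step n f g}.
Proof.
case=> {f es} [f t i v j rf|f t1 j v js t2 pf|f t1 t2 pf arr|f t js pf|f t1 js t2 pf w2 w1] okf;
  (split; first by []).
- move=> g; rewrite !inE => /orP[] /eqP->; apply: norm_step_rw => //; auto.
- have [/= + sh] := norm_ok_atom pf okf.
  case E1: (sort_of t1) => [[//|J V]|//]; case: andP => // -[/eqP Ej /eqP Ev].
  case/andP=> /eqP E2 /allP sjs.
  have aj : array_sorted j = false by rewrite /array_sorted Ej.
  have sij : all (fun i => sort_of j == sort_of i) js.
    by apply/allP=> i /sjs /eqP->; rewrite Ej.
  have okm : norm_ok n (mem_vec j js).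
    rewrite /norm_ok well_sortedE atoms_mem_vec !all_map -all_predI.
    by apply/allP=> i /sjs /eqP Ei; rewrite /= Ej Ei aj eqxx.
  have [t1f vf jf] : [/\ {subset subterms t1 <= terms f},
      {subset subterms v <= terms f} & {subset subterms j <= terms f}].
    by split=> u us; apply: mem_terms pf _; rewrite /= inE !mem_cat us !orbT.
  have [jsf t2f] : {subset flatten (map subterms js) <= terms f} /\
      {subset subterms t2 <= terms f}.
    by split=> u us; apply: mem_terms pf _; rewrite /= inE !mem_cat us !orbT.
  have js_n : size js <= n by move: sh => /=; lia.
  have w2 := wrank_gt0 t2.
  set K := 2 * n + 10.
  have wE : (wrank t1 + wrank v).+1 * wrank t2 =
      wrank t1 * wrank t2 + wrank v * wrank t2 + wrank t2 by lia.
  move=> g; rewrite !inE => /orP[] /eqP->.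
  + apply: (@norm_step_memb _ _ _ _ _ _ _ 0 pf okf _ js_n okm sij aj _ jf jsf) => //=;
      auto; try lia.
    * by rewrite /norm_ok /= E1 E2 eqxx /=; apply/andP; split; [apply/allP|move: sh => /=; lia].
    * move=> h hs; apply: rdsum_sub => u /hs; rewrite !mem_cat.
      by do ?[by []|by move/t1f|by move/jsf|by move/t2f|case/orP].
    * rewrite -/K /weight /= big_seq1 /= andbF wE.
      have KE : K = 2 * n + 10 by [].
      have := leq_mul (leqnn K) w2; clearbody K; case: (is_wr t2 && _); lia.
  + apply: (@norm_step_memb _ _ _ _ _ _ _ (wrank t2) pf okf _ js_n okm sij aj _ jf jsf)
      => //=; auto; try lia.
    * rewrite /norm_ok /= -E2 E1 all_rcons Ej Ev !eqxx /=.
      rewrite size_rcons !andbT; apply/and3P; split; first exact/allP.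
        by move: sh => /=; lia.
      by apply/implyP=> _; move: sh => /=; lia.
    * by rewrite map_rcons sumn_rcons; lia.
    * move=> h hs; apply: (@rdsum_cons _ _ (Rd t2 j)) => u /hs; rewrite inE !mem_cat /=.
      rewrite map_rcons flatten_rcons !(mem_cat, inE); case: eqP => //= _.
      by do ?[by []|by move/t1f|by move/jsf|by move/t2f|by move/vf|by move/jf|case/orP].
    * rewrite -/K /weight /= big_cons big_seq1 /= andbF wE.
      have KE : K = 2 * n + 10 by [].
      have := leq_mul (leqnn K) w2; clearbody K.
      by case: (is_wr t2 && _); case: (array_sorted v); lia.
- have [/= /andP[s1 /eqP E12] sh] := norm_ok_atom pf okf.
  move=> g; rewrite inE => /eqP->.
  have subt h : {subset terms h <= terms (Eq t1 t2) ++ terms f} -> rdsum h <= 0 + rdsum f.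
    move=> hs; apply: rdsum_sub => u /hs; rewrite mem_cat => /orP[|//]; exact: mem_terms.
  apply: (@norm_step_repl_atom _ _ _ _ 1 0) => //; rewrite ?mul1n //=; try lia.
  + rewrite arr in sh; move: s1 arr; rewrite /norm_ok /array_sorted /= -E12.
    by case: (sort_of t1) => [[//|J V]|//] _ _; rewrite eqxx /= andbT; move: sh => /=; lia.
  + by apply: subt => u /terms_repl_atom us; rewrite mem_cat; apply/orP; exact: us.
  + rewrite /weight /= big_seq1 /= arr; case: (_ && _); lia.
- move=> g; rewrite inE => /eqP->.
  apply: (@norm_step_repl_atom _ _ _ _ 1 0) => //; rewrite ?mul1n //=; try lia.
  + by apply: rdsum_sub => u /terms_repl_atom[].
  + by rewrite /weight big_nil /=; have := wrank_gt0 t; nia.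
- have [/= ws sh] := norm_ok_atom pf okf.
  move=> g; rewrite inE => /eqP->.
  apply: (@norm_step_repl_atom _ _ _ _ 1 0) => //; rewrite ?mul1n //=; try lia.
  + rewrite /norm_ok /= andbT; move: ws sh => /=; case E: (sort_of t1) => [[//|J V]|//].
    by case/andP=> /eqP<- -> /=; rewrite eqxx /=; lia.
  + apply: rdsum_sub => u /terms_repl_atom[|//] us; apply: mem_terms pf _.
    by move: us; rewrite /= !mem_cat => /or3P[]->; rewrite ?orbT.
  + by rewrite /weight /= big_seq1 /= w2 (negbTE w1) /= ?andbF (mulnC (wrank t2)); lia.
Qed.

Lemma size_subterms t : size (subterms t) = tsize t.
Proof. by elim: t => //= *; rewrite !size_cat; lia. Qed.

Lemma leq_size_sumn_tsize js : size js <= sumn (map tsize js).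
Proof. by elim: js => //= j js IH; have := tsize_gt0 j; lia. Qed.

Lemma leq_size_terms f : size (terms f) <= fsize f.
Proof.
elim: f => //= [t u|t js u|f|f IHf g IHg|f IHf g IHg|f IHf g IHg];
  rewrite ?size_cat ?size_subterms; try lia.
suff -> : size (flatten (map subterms js)) = sumn (map tsize js) by lia.
by elim: js => //= j js IH; rewrite size_cat IH size_subterms.
Qed.

Lemma leq_nconn_fsize f : nconn f + size (atoms f) <= fsize f.
Proof. by elim: f => //= *; rewrite ?size_cat; lia. Qed.

Lemma leq_rdsum f : rdsum f <= fsize f * fsize f.
Proof.
rewrite /rdsum; apply: (@leq_trans (\sum_(t <- undup (terms f)) fsize f)).
  apply: leq_sum_seq_in => t; rewrite mem_undup => /leq_tsize_terms.
  by have := wrank_tsize t; have := rdrank_wrank t; lia.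
rewrite big_const_seq count_predT iter_addn_0 mulnC leq_mul2r.
by rewrite (leq_trans (size_undup _) (leq_size_terms f)) orbT.
Qed.

Lemma leq_apot K n p : 0 < n -> fsize p <= n -> apot K p <= 1 + 8 * K * (n * n).
Proof.
move=> n0; case: p => //= [t u|t js u] le_n.
- have := wrank_tsize t; have := wrank_tsize u => wu wt.
  have /(leq_mul (leqnn K)) : wrank t * wrank u <= n * n by apply: leq_mul; lia.
  have /(leq_mul (leqnn K)) : 1 <= n * n by rewrite muln_gt0 n0.
  by case: (array_sorted t); lia.
- have := wrank_tsize t; have := wrank_tsize u => wu wt.
  have /(leq_mul (leqnn K)) : wrank t * wrank u <= n * n by apply: leq_mul; lia.
  have /(leq_mul (leqnn K)) : 1 <= n * n by rewrite muln_gt0 n0.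
  by case: (_ && _); lia.
Qed.

Lemma leq_npot_init f :
  npot (2 * fsize f + 10) f <= 128 * fsize f ^ 4.
Proof.
have n0 := fsize_gt0 f; set n := fsize f in n0 *; set K := 2 * n + 10.
have leK : K <= 12 * n by lia.
have le_at : \sum_(p <- atoms f) apot K p <= n * (1 + 8 * K * (n * n)).
  apply: (@leq_trans (\sum_(p <- atoms f) (1 + 8 * K * (n * n)))).
    by apply: leq_sum_seq_in => p /fsize_atom; apply: leq_apot.
  rewrite big_const_seq count_predT iter_addn_0 mulnC leq_mul2r.
  by have := leq_nconn_fsize f; rewrite -/n => le; rewrite (leq_trans _ le) ?leq_addl ?orbT.
have le_nc : nconn f <= n by have := leq_nconn_fsize f; rewrite -/n; lia.
have le_rd := leq_rdsum f; rewrite -/n in le_rd.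
have le1 : K * rdsum f <= 12 * n * (n * n) by apply: leq_mul.
have le2 : K * (n * n) * n <= 12 * n * (n * n) * n by rewrite !leq_mul.
have le3 : n * (n * n) <= n * n * n * n by nia.
have le4 : n <= n * n * n * n by nia.
rewrite /npot /weight !expnS expn0; lia.
Qed.

Lemma norm_ok_init f : well_sorted f -> norm_ok (fsize f) f.
Proof.
move=> wf; rewrite /norm_ok wf; apply/allP=> p /fsize_atom.
case: p => //= [t u|t js u]; have := wrank_tsize t; have := wrank_tsize u.
  by case: (array_sorted t) => //=; lia.
by have := leq_size_sumn_tsize js; lia.
Qed.

(** * Rewriting a disjunct inside a disjunction *)

Lemma in_disjunct_step (T : Type) (rule : T -> seq T -> Prop) (I : pred T)
    (W : T -> nat) ds ds' :
  (forall d es, rule d es -> I d -> all I es /\ \sum_(e <- es) W e < W d) ->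
  in_disjunct rule ds ds' -> all I ds ->
  all I ds' /\ \sum_(d <- ds') W d < \sum_(d <- ds) W d.
Proof.
move=> ruleP [l [d [r [es [-> rde ->]]]]]; rewrite !all_cat /=.
case/and3P=> Il Id Ir; have [Ies lt_es] := ruleP d es rde Id.
rewrite Il Ies Ir !big_cat big_cons /=; split=> //; lia.
Qed.

Lemma fixed_point_cons (T : Type) (rule : T -> seq T -> Prop) d ds :
  fixed_point rule (d :: ds) ->
  (forall es, ~ rule d es) /\ fixed_point rule ds.
Proof.
move=> fix_ds; split=> [es rde|[ds' [l [e [r [es [dsE rde _]]]]]]]; apply: fix_ds.
  by exists (es ++ ds), [::], d, ds, es.
by exists ((d :: l) ++ es ++ r), (d :: l), e, r, es; rewrite dsE.
Qed.

Lemma fixed_point_all (T : Type) (rule : T -> seq T -> Prop) (P Q : pred T) ds :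
  (forall d, P d -> (forall es, ~ rule d es) -> Q d) ->
  fixed_point rule ds -> all P ds -> all Q ds.
Proof.
move=> PQ; elim: ds => //= d ds IH fix_ds /andP[Pd Pds].
have [nod fix_ds'] := fixed_point_cons fix_ds.
by rewrite (PQ d Pd nod) IH.
Qed.

Lemma sum_pow3_lt (T : Type) (m : T -> nat) (b : nat) (es : seq T) :
  size es <= 2 -> all (fun e => m e < b) es -> \sum_(e <- es) 3 ^ m e < 3 ^ b.
Proof.
case: b => [|b]; first by case: es => //= _ _; rewrite big_nil.
have le3 x : m x < b.+1 -> 3 ^ m x <= 3 ^ b by move=> lt; rewrite leq_exp2l.
have gt0 : 0 < 3 ^ b by rewrite expn_gt0.
rewrite expnS; case: es => [|x [|y [|]]] //= _; rewrite ?big_cons big_nil; first by lia.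
  by rewrite andbT => /le3; lia.
by case/and3P=> /le3 ? /le3 ? _; lia.
Qed.

(** * Normal forms *)

Lemma is_atom p f : p \in atoms f -> if p is (Eq _ _ | PEq _ _ _) then true else false.
Proof.
elim: f => //= [t u|t js u|f IHf g IHg|f IHf g IHg|f IHf g IHg].
- by rewrite inE => /eqP->.
- by rewrite inE => /eqP->.
all: by rewrite mem_cat => /orP[/IHf|/IHg].
Qed.

Definition on_or_read (a : var) (t : term) : bool := (t == Var a) || only_read_t a t.

Definition normal_atom (a : var) (p : formula) : bool :=
  match p with
  | PEq t js u =>
      [&& t != u, on_or_read a t, all (only_read_t a) js & on_or_read a u]
  | _ => only_read a p
  end.

Definition normal_lit (a : var) (f : formula) : bool :=
  match f with
  | PEq t js u | Not (PEq t js u) =>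
      [&& t == Var a, all (only_read_t a) js & only_read_t a u]
  | _ => false
  end.

Definition normal_rd (a : var) (f : formula) : bool :=
  if f is Eq s (Rd b t) then [&& tfree_of a s, b == Var a & tfree_of a t] else false.

Lemma no_write_on_or_read a I V t :
  a.1 = Arr I V -> isSome (sort_of t) -> ~~ is_wr t ->
  (forall u i v j, Rd (Wr u i v) j \notin subterms t) -> on_or_read a t.
Proof.
move=> aE; elim: t => [x|t IHt i IHi|//] /=; rewrite /on_or_read /=.
  by move=> _ _ _; have [->|ne] := eqVneq x a; [rewrite eqxx|rewrite orbT].
case Et: (sort_of t) => [[//|J U]|//]; case: eqP => // Ei _ _ nowr.
have nowr_t u k v j : Rd (Wr u k v) j \notin subterms t.
  by have := nowr u k v j; rewrite inE mem_cat !negb_or => /and3P[].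
have nowr_i u k v j : Rd (Wr u k v) j \notin subterms i.
  by have := nowr u k v j; rewrite inE mem_cat !negb_or => /and3P[].
have nt : ~~ is_wr t.
  case: t {IHt Et nowr_t} nowr => // u k v /(_ u k v i).
  by rewrite mem_head.
have ni : ~~ is_wr i.
  case: i Ei {IHi nowr nowr_i} => //= u k v; case: (sort_of u) => [[//|? ?]|//].
  by case: ifP.
have := IHt; rewrite Et => /(_ isT nt nowr_t); rewrite /on_or_read => -> /=.
have := IHi; rewrite Ei => /(_ isT ni nowr_i) /orP[/eqP iE|//].
by rewrite iE /= aE in Ei.
Qed.

Lemma basic_only_read a I V t J :
  a.1 = Arr I V -> sort_of t = Some (Basic J) ->
  (forall u i v j, Rd (Wr u i v) j \notin subterms t) -> only_read_t a t.
Proof.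
move=> aE st nowr; have nt : ~~ is_wr t.
  case: t st {nowr} => //= u k v; case: (sort_of u) => [[//|? ?]|//].
  by case: ifP.
have := no_write_on_or_read aE _ nt nowr; rewrite st => /(_ isT) /orP[/eqP tE|//].
by rewrite tE /= aE in st.
Qed.

Lemma norm_fixed_normal a I V f :
  a.1 = Arr I V -> well_sorted f -> (forall es, ~ norm_rule f es) ->
  all (normal_atom a) (atoms f).
Proof.
move=> aE wf nof; apply/allP=> p pf.
have nowr u i v j : Rd (Wr u i v) j \notin terms p.
  by apply/negP=> /(mem_terms pf) /(ElimWrRd); apply: nof.
have wp : well_sorted p by move: wf; rewrite well_sortedE => /allP/(_ p pf).
case: p pf (is_atom pf) nowr wp => //= [t u|t js u] pf _ nowr.
  case/andP=> st /eqP tu.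
  have : ~~ array_sorted t by apply/negP=> /(PartialEq pf); apply: nof.
  rewrite /array_sorted; case Et: (sort_of t) st => [[J|//]|//] _ _.
  apply/andP; split.
    apply: (basic_only_read aE Et) => x i v j.
    by have := nowr x i v j; rewrite mem_cat negb_or => /andP[].
  rewrite tu in Et; apply: (basic_only_read aE Et) => x i v j.
  by have := nowr x i v j; rewrite mem_cat negb_or => /andP[].
case Et: (sort_of t) => [[//|J U]|//] /andP[/eqP tu /allP sjs].
have nt : ~~ is_wr t.
  by case: t pf {nowr Et} => // x k v /ElimWrEq; case/(nof _).
have nu : ~~ is_wr u by apply/negP=> wu; apply: nof (Symm pf wu nt).
apply/and4P; split.
- by apply/eqP=> E; rewrite E in pf; apply: nof (TrivEq pf).
- apply: (no_write_on_or_read aE) => //; first by rewrite Et.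
  by move=> x i v j; have := nowr x i v j; rewrite !mem_cat negb_or => /andP[].
- apply/allP=> i ijs; apply: (basic_only_read aE (eqP (sjs i ijs))) => x k v j.
  apply/negP=> inr; have := nowr x k v j; rewrite !mem_cat.
  by rewrite (_ : _ \in flatten _) ?orbT //; apply/flatten_mapP; exists i.
- apply: (no_write_on_or_read aE) => //; first by rewrite -tu.
  by move=> x i v j; have := nowr x i v j; rewrite !mem_cat !negb_or => /and3P[].
Qed.

(** * Case splitting and factoring *)

Definition split_ok (a : var) (D B : nat) (d : disjunct) : bool :=
  [&& nilp (ex d), nilp (rds d), all (normal_atom a) (atoms (body d)),
      all (normal_lit a) (lits d),
      nconn (body d) + 2 * size (atoms (body d)) + size (lits d) <= 2 * D
    & fsize (body d) + fsizes (lits d) + 2 * size (atoms (body d)) <= B].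

Lemma atoms_repl_const p b f :
  atoms b = [::] -> atoms (repl_atom p b f) = [seq x <- atoms f | x != p].
Proof.
move=> ab; rewrite atoms_repl_atom; elim: (atoms f) => //= x s ->.
by rewrite ab; case: eqP.
Qed.

Lemma fsizes_rcons fs f : fsizes (rcons fs f) = fsizes fs + fsize f.
Proof. by rewrite /fsizes map_rcons sumn_rcons. Qed.

Lemma split_rule_step a D B d es :
  split_rule a d es -> split_ok a D B d ->
  all (split_ok a D B) es /\
  \sum_(e <- es) 3 ^ size (atoms (body e)) < 3 ^ size (atoms (body d)).
Proof.
case=> {d es} xs f ls rs p js t pf pE /and5P[/= nx nr okf okl /andP[leD leB]].
have pok := allP okf p pf.
have lok : normal_lit a (PEq (Var a) js t).
  case: pE pok => -> /= /and4P[ne /orP[/eqP tE|ta] -> /orP[/eqP uE|ua]];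
    by rewrite ?eqxx ?ta ?ua //; rewrite ?tE ?uE eqxx in ne.
have lp : fsize (PEq (Var a) js t) = fsize p by case: pE => -> /=; lia.
have step b : nconn b = 1 -> atoms b = [::] ->
   [/\ size (atoms (repl_atom p b f)) < size (atoms f),
       all (normal_atom a) (atoms (repl_atom p b f)),
       nconn (repl_atom p b f) + 2 * size (atoms (repl_atom p b f)) + 1 <=
         nconn f + 2 * size (atoms f)
     & fsize (repl_atom p b f) + fsize p + 1 + 2 * size (atoms (repl_atom p b f)) <=
         fsize f + 2 * size (atoms f)].
  move=> nb ab; have cnt : 0 < count_mem p (atoms f) by rewrite -has_count has_pred1.
  have szE : size (atoms (repl_atom p b f)) + count_mem p (atoms f) = size (atoms f).
    by rewrite atoms_repl_const // size_filter addnC count_predC.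
  have le_f : fsize (repl_atom p b f) + (fsize p - 1) <= fsize f.
    rewrite [fsize (repl_atom _ _ _)]fsizeE [fsize f]fsizeE.
    apply: weight_repl_atom_lt => //.
    by rewrite /weight nb ab big_nil; have := fsize_gt0 p; lia.
  split; first by lia.
  - rewrite atoms_repl_const //; apply/allP=> x; rewrite mem_filter => /andP[_].
    exact: (allP okf).
  - by rewrite nconn_repl_atom nb; lia.
  - by have := fsize_gt0 p; lia.
have [lt1 ok1 c1 s1] := step Top erefl erefl.
have [lt2 ok2 c2 s2] := step Bot erefl erefl.
split; last by apply: sum_pow3_lt => //=; rewrite lt1 lt2.
rewrite /= /split_ok /= nx nr ok1 ok2 !all_rcons okl !size_rcons !fsizes_rcons.
rewrite -[normal_lit a (Not _)]/(normal_lit a (PEq (Var a) js t)) lok.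
rewrite -[fsize (Not _)]/(fsize (PEq (Var a) js t)).+1 lp.
by apply/and3P; split=> //; apply/andP; split; lia.
Qed.

Lemma split_fixed_only_read a D B d :
  split_ok a D B d -> (forall es, ~ split_rule a d es) -> only_read a (body d).
Proof.
case: d => xs f ls rs /and3P[_ _ /andP[/= okf _]] nod.
rewrite only_readE; apply/allP=> p pf; have := allP okf p pf.
case: p pf => //= t js u pf /and4P[_ ta -> ua].
have nt : t != Var a.
  by apply/eqP=> tE; rewrite tE in pf; apply: nod (CaseSplitEq _ _ _ pf _); left.
have nu : u != Var a.
  by apply/eqP=> uE; rewrite uE in pf; apply: nod (CaseSplitEq _ _ _ pf _); right.
by move: ta ua; rewrite /on_or_read (negbTE nt) (negbTE nu) /= => -> ->.
Qed.

Definition factor_ok (a : var) (D B : nat) (d : disjunct) : bool :=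
  [&& only_read a (body d), all (normal_lit a) (lits d), all (normal_rd a) (rds d),
      nconn (body d) + size (lits d) <= 2 * D
    & size (ex d) + fsizes (rds d) + 6 * (fsize (body d) + fsizes (lits d)) <= 6 * B].

Lemma only_read_t_replt a i s t :
  s != a -> only_read_t a t -> only_read_t a (replt (Rd (Var a) i) (Var s) t).
Proof.
move=> sa; elim: t => [x|t IHt j IHj|t IHt j IHj v IHv] //=.
  case/andP=> ta ja; case: ifP => // _ /=.
  by rewrite IHj // andbT; case/orP: ta => [/eqP-> /=|/IHt->]; rewrite ?eqxx ?orbT.
by case/and3P=> /IHt-> /IHj-> /IHv->.
Qed.

Lemma only_read_repl a i s f :
  s != a -> only_read a f -> only_read a (repl (Rd (Var a) i) (Var s) f).
Proof.
move=> sa; elim: f => //= [t u|t js u|f IHf g IHg|f IHf g IHg|f IHf g IHg].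
- by case/andP=> ta ua; rewrite !only_read_t_replt.
- case/and3P=> ta /allP jsa ua; rewrite !only_read_t_replt // andbT all_map.
  by apply/allP=> j /jsa /=; apply: only_read_t_replt.
all: by case/andP=> /IHf-> /IHg->.
Qed.

Lemma normal_lit_repl a i s f :
  s != a -> normal_lit a f -> normal_lit a (repl (Rd (Var a) i) (Var s) f).
Proof.
move=> sa; have lit t js u : [&& t == Var a, all (only_read_t a) js & only_read_t a u] ->
    normal_lit a (repl (Rd (Var a) i) (Var s) (PEq t js u)).
  case/and3P=> /eqP-> /allP jsa ua; rewrite /= eqxx only_read_t_replt // andbT all_map.
  by apply/allP=> j /jsa /=; apply: only_read_t_replt.
by case: f => // -[] // t js u; apply: lit.
Qed.

Lemma leq_fsizes_repl r s fs :
  tsize s <= tsize r ->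
  fsizes (map (repl r s) fs) + (r \in flatten (map terms fs)) * (tsize r - tsize s)
    <= fsizes fs.
Proof.
move=> le_sr; rewrite /fsizes; elim: fs => //= f fs IH; rewrite mem_cat.
have := leq_fsize_repl f le_sr.
by case: (r \in terms f); case: (r \in flatten _) IH => /=; lia.
Qed.

Lemma factor_rule_step a D B d es :
  factor_rule a d es -> factor_ok a D B d ->
  all (factor_ok a D B) es /\
  \sum_(e <- es) (fsize (body e) + fsizes (lits e)) < fsize (body d) + fsizes (lits d).
Proof.
case=> {d es} xs f ls rs t s rf ta sE /and3P[sa _ _] /and5P[/= okf okl okr leD leB].
set r := Rd (Var a) t in rf *.
have le_f : fsize (repl r (Var s) f) + fsizes (map (repl r (Var s)) ls) + tsize t + 1 <=
    fsize f + fsizes ls.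
  have := @leq_fsizes_repl r (Var s) (f :: ls) isT; rewrite rf mul1n /fsizes /= -/r.
  by lia.
split; last by rewrite big_seq1 /=; move: le_f; rewrite /=; lia.
rewrite /= andbT /factor_ok /= only_read_repl // all_map all_rcons okr nconn_repl.
rewrite /= !eqxx ta /tfree_of /= inE size_map leD size_rcons fsizes_rcons.
rewrite (_ : Var a != Var s) /=; last by apply: contraNneq sa => -[->].
rewrite (_ : all _ ls) /=; last first.
  by apply/allP=> x /(allP okl) /=; apply: normal_lit_repl.
by move: le_f; rewrite /=; lia.
Qed.

Lemma only_read_tfree a t :
  only_read_t a t ->
  (forall i, tfree_of a i -> Rd (Var a) i \notin subterms t) -> tfree_of a t.
Proof.
rewrite /tfree_of; elim: t => [x|t IHt i IHi|t IHt i IHi v IHv] /=.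
- by rewrite inE => + _; apply: contraNneq => -[->].
- case/andP=> ta ia no; rewrite inE mem_cat /=.
  have fi : Var a \notin subterms i.
    apply: IHi => // j /no; rewrite inE mem_cat !negb_or; by case/and3P.
  rewrite (negbTE fi) orbF; case/orP: ta => [/eqP tE|ta].
    by have := no i fi; rewrite tE mem_head.
  apply: IHt => // j /no; rewrite inE mem_cat !negb_or; by case/and3P.
- case/and3P=> ta ia va no; rewrite inE !mem_cat /= !negb_or.
  by apply/and3P; split; [apply: IHt|apply: IHi|apply: IHv] => // j /no;
    rewrite inE !mem_cat !negb_or; case/and4P.
Qed.

Lemma only_read_free a f :
  only_read a f ->
  (forall i, tfree_of a i -> Rd (Var a) i \notin terms f) -> Var a \notin terms f.
Proof.
move=> oa no; rewrite termsE; apply/negP=> /flatten_mapP[p pf].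
have {oa} := oa; rewrite only_readE => /allP /(_ p pf) op.
have {no} no i : tfree_of a i -> Rd (Var a) i \notin terms p.
  by move=> /no; apply: contraNN; apply: mem_terms.
have free t : only_read_t a t -> {subset subterms t <= terms p} ->
    Var a \notin subterms t.
  by move=> ota sub; apply: only_read_tfree ota _ => i /no; apply: contraNN; apply: sub.
apply/negP; case: p pf (is_atom pf) op no free => //= [t u|t js u] _ _.
- case/andP=> ta ua _ free; rewrite mem_cat negb_or !free //;
    by move=> x xs; rewrite mem_cat xs ?orbT.
- case/and3P=> ta /allP jsa ua _ free; rewrite !mem_cat !negb_or.
  rewrite !free //=; try by move=> x xs; rewrite !mem_cat xs ?orbT.
  rewrite andbT; apply/negP=> /flatten_mapP[j jjs]; apply/negP/free; first exact: jsa.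
  move=> x xs; rewrite !mem_cat; apply/orP; right; apply/orP; left.
  by apply/flatten_mapP; exists j.
Qed.

(** * Fresh variables *)

Definition term_index (t : term) : nat := if t is Var x then x.2 else 0.

Lemma fresh_vars a xs fs (S : asort) (k : nat) :
  exists vs, [/\ size vs = k, uniq vs, all (fun x : var => x.1 == S) vs
               & all (fresh a xs fs) vs].
Proof.
have [M [Ma Mxs Mfs]] : exists M, [/\ a.2 <= M, \sum_(x <- xs) x.2 <= M
    & \sum_(t <- flatten (map terms fs)) term_index t <= M].
  exists (a.2 + \sum_(x <- xs) x.2 + \sum_(t <- flatten (map terms fs)) term_index t).
  by split; lia.
exists [seq (S, M.+1 + i) | i <- iota 0 k]; split.
- by rewrite size_map size_iota.
- by rewrite map_inj_uniq ?iota_uniq // => i j [/addnI].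
- by rewrite all_map; apply/allP=> i _ /=; rewrite eqxx.
- rewrite all_map; apply/allP=> i _ /=; rewrite /fresh; apply/and3P; split.
  + by apply/eqP=> E; move: Ma; rewrite -E /=; lia.
  + by apply/negP=> /(leq_big_seq_mem (fun x : var => x.2)) /leq_trans/(_ Mxs) /=; lia.
  + apply/allP=> f ffs; apply/negP=> xf.
    have /(leq_big_seq_mem term_index) /leq_trans/(_ Mfs) /= :
        Var (S, M.+1 + i) \in flatten (map terms fs) by apply/flatten_mapP; exists f.
    by lia.
Qed.

Lemma fresh_var a xs fs (S : asort) :
  exists s : var, s.1 = S /\ fresh a xs fs s.
Proof.
have [vs [+ _ + +]] := fresh_vars a xs fs S 1.
case: vs => // s vs _ /= /andP[/eqP sS _] /andP[sfr _].
by exists s.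
Qed.

(** * Disjunctive normal form *)

Fixpoint conn (f : formula) : nat :=
  match f with
  | Top | Bot => 1
  | Eq _ _ | PEq _ _ _ => 0
  | Not f => (conn f).+1
  | And f g | Or f g | Imp f g => (conn f + conn g).+2
  end.

Definition conns (fs : seq formula) : nat := sumn (map conn fs).

Lemma leq_conn f : conn f <= 2 * nconn f.
Proof. elim: f => //= *; lia. Qed.

Definition free_lit (a : var) (f : formula) : bool :=
  match f with
  | PEq t _ u | Not (PEq t _ u) => (t == Var a) && tfree_of a u
  | _ => false
  end.

Definition liftable (a : var) (f : formula) : bool :=
  [|| Var a \notin terms f, free_lit a f | normal_rd a f].

Definition lift_ok (a : var) (B : nat) (c : clause) : bool :=
  all (liftable a) c.2 && (size c.1 + fsizes c.2 <= B).

Lemma factor_fixed_liftable a D B d :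
  factor_ok a D B d -> (forall es, ~ factor_rule a d es) ->
  lift_ok a (6 * B) (clause_of d) && (conns (clause_of d).2 <= 4 * D).
Proof.
case: d => xs f ls rs /and5P[/= okf okl okr leD leB] nod.
have no i : tfree_of a i -> Rd (Var a) i \notin flatten (map terms (f :: ls)).
  move=> fi; apply/negP=> ri.
  have [s [sS sfr]] := fresh_var a xs (f :: ls ++ rs) (val_sort a).
  exact: nod (FactorRd ri fi sS sfr).
have ff : Var a \notin terms f.
  apply: only_read_free okf _ => i /no; rewrite /= mem_cat negb_or; by case/andP.
have cat3 F : sumn (map F (f :: ls ++ rs)) = F f + sumn (map F ls) + sumn (map F rs).
  by rewrite /= map_cat sumn_cat addnA.
have lf : liftable a f by rewrite /liftable ff.
rewrite /lift_ok /= lf all_cat; apply/andP; split; last first.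
  rewrite /conns cat3; have := leq_conn f.
  have : sumn (map conn ls) <= size ls.
    elim: ls okl {okf okr leD leB nod no cat3} => //= l ls IH /andP[okl /IH].
    suff : conn l <= 1 by lia.
    by case: l okl => // -[].
  have -> : sumn (map conn rs) = 0; last by lia.
  elim: rs okr {leB cat3 nod} => //= r rs IH /andP[okr /IH->].
  by case: r okr => // t [].
have -> : size xs + fsizes (f :: ls ++ rs) <= 6 * B.
  by rewrite /fsizes cat3; move: leB; rewrite /fsizes; lia.
have -> : all (liftable a) rs.
  by apply/allP=> r /(allP okr); rewrite /liftable => ->; rewrite !orbT.
rewrite !andbT; apply/allP=> l ll; have := allP okl l ll.
have nol i : tfree_of a i -> Rd (Var a) i \notin terms l.
  move=> /no; apply: contraNN => ri; rewrite /= mem_cat; apply/orP; right.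
  by apply/flatten_mapP; exists l.
have free t js u : terms l = terms (PEq t js u) -> only_read_t a u -> tfree_of a u.
  move=> lE /only_read_tfree; apply=> i /nol; apply: contraNN => ri.
  by rewrite lE /= !mem_cat ri !orbT.
rewrite /liftable /normal_lit /free_lit.
case: (l) free => //= [t js u|[] // t js u] free;
  by case/and3P=> -> _ /(free _ _ _ erefl)->; rewrite orbT.
Qed.

Lemma bool_rewrite_ok a f alts : bool_rewrite f = Some alts -> liftable a f ->
  size alts <= 2 /\
  all (fun alt => [&& all (liftable a) alt, conns alt < conn f & fsizes alt <= fsize f]) alts.
Proof.
have free_liftable g : Var a \notin terms g -> liftable a g by move=> fg; rewrite /liftable fg.
move=> fE lf; have {lf} ff : Var a \notin terms f.
  by case/or3P: lf fE => [//| |]; case: f => // -[].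
move: ff; case: f fE => //= [||f|f g|f g|f g].
- by move=> [<-].
- by move=> [<-].
- case: f => //= [||f|f g|f g|f g] [<-] //=; rewrite ?mem_cat ?negb_or.
  + by move=> ff; rewrite free_liftable //= /conns /fsizes /=; split=> //; lia.
  + case/andP=> ff fg; rewrite !free_liftable //= /conns /fsizes /=; split=> //; lia.
  + case/andP=> ff fg; rewrite !free_liftable //= /conns /fsizes /=; split=> //; lia.
  + case/andP=> ff fg; rewrite !free_liftable //= /conns /fsizes /=; split=> //; lia.
- move=> [<-]; rewrite mem_cat negb_or /=; case/andP=> ff fg.
  rewrite !free_liftable //= /conns /fsizes /=; split=> //; lia.
- move=> [<-]; rewrite mem_cat negb_or /=; case/andP=> ff fg.
  rewrite !free_liftable //= /conns /fsizes /=; split=> //; lia.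
- move=> [<-]; rewrite mem_cat negb_or /=; case/andP=> ff fg.
  rewrite !free_liftable //= /conns /fsizes /=; split=> //; lia.
Qed.

Lemma lift_rule_step a B c es :
  lift_rule c es -> lift_ok a B c ->
  all (lift_ok a B) es /\ \sum_(e <- es) 3 ^ conns e.2 < 3 ^ conns c.2.
Proof.
case=> {c es} xs fs f gs alts fE; rewrite /lift_ok /= all_cat /=.
case/andP=> /and3P[okfs okf okgs] leB; have [sz /allP okalts] := bool_rewrite_ok fE okf.
have sumE F alt : sumn (map F (fs ++ alt ++ gs)) =
    sumn (map F fs) + sumn (map F alt) + sumn (map F gs).
  by rewrite !map_cat !sumn_cat addnA.
have sumE1 F : sumn (map F (fs ++ f :: gs)) =
    sumn (map F fs) + F f + sumn (map F gs).
  by rewrite -cat1s sumE /= addn0.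
split.
  rewrite all_map; apply/allP=> alt /okalts /and3P[oka _ sza].
  rewrite /= !all_cat okfs oka okgs /=.
  by move: leB sza; rewrite /fsizes sumE sumE1; lia.
apply: sum_pow3_lt; rewrite ?size_map // all_map.
apply/allP=> alt /okalts /and3P[_ ca _] /=.
by move: ca; rewrite /conns sumE sumE1; lia.
Qed.

(** * Elimination *)

Lemma lifted_exists a c : all (liftable a) c.2 -> exists d, lifted a c d.
Proof.
case: c => xs fs /= okfs.
suff [d [dx dp df]] : exists d, [/\ d_ex d = xs,
    forall P, count P (delta_conjs a d) = count P fs & free_of a (d_core d)].
  by exists d; split=> //; apply/permP.
elim: fs okfs => [_|f fs IH /= /andP[okf /IH[[ys cs es ds rs] [/= dx dp df]]]].
  by exists (Delta xs [::] [::] [::] [::]).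
have dpE P : count P (delta_conjs a (Delta ys cs es ds rs)) =
   count P cs + count P (eq_lits a es) + count P (diseq_lits a ds) + count P (rd_lits a rs).
  by rewrite /delta_conjs /= !count_cat !addnA.
case/or3P: okf => [ff|okf|okf].
- exists (Delta ys (f :: cs) es ds rs); split=> //=; last by rewrite ff.
  by move=> P; rewrite -dp /delta_conjs /= -[cs ++ _]/(delta_conjs a (Delta ys cs es ds rs)).
- case: f okf => // [t js u|[] // t js u] /= /andP[/eqP-> _].
  + exists (Delta ys cs ((js, u) :: es) ds rs); split=> // P.
    by rewrite -dp dpE /delta_conjs /eq_lits /diseq_lits /rd_lits /= !count_cat /= ?count_cat; lia.
  + exists (Delta ys cs es ((js, u) :: ds) rs); split=> // P.
    by rewrite -dp dpE /delta_conjs /eq_lits /diseq_lits /rd_lits /= !count_cat /= ?count_cat; lia.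
- case: f okf => // s [] // b t /= /and3P[_ /eqP-> _].
  exists (Delta ys cs es ds ((s, t) :: rs)); split=> // P.
  by rewrite -dp dpE /delta_conjs /eq_lits /diseq_lits /rd_lits /= !count_cat /= ?count_cat; lia.
Qed.

Lemma lifted_exists_all a cs :
  all (fun c => all (liftable a) c.2) cs -> exists ds, List.Forall2 (lifted a) cs ds.
Proof.
elim: cs => [_|c cs IH /= /andP[okc /IH[ds okds]]]; first by exists [::].
by have [d okd] := lifted_exists okc; exists (d :: ds); constructor.
Qed.

Definition elim_ok (a : var) (B B' : nat) (p : pending) : bool :=
  match p with
  | inl d =>
      [&& free_of a (d_core d), all (fun e => tfree_of a e.2) (d_eqs d),
          all (fun e => tfree_of a e.2) (d_diseqs d),
          all (fun r => tfree_of a r.1 && tfree_of a r.2) (d_rds d)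
        & pending_size a p <= B]
  | inr _ => pending_size a p <= B'
  end.

Lemma lifted_elim_ok a B B' c d :
  lift_ok a B c -> lifted a c d -> elim_ok a B B' (inl d).
Proof.
case: c d => xs fs [ys cs es ds rs] /andP[/= okfs leB] [/= -> perm fr].
have ok : all (liftable a) (delta_conjs a (Delta xs cs es ds rs)) by rewrite (perm_all _ perm).
rewrite fr /=; move: (ok); rewrite /delta_conjs /= !all_cat !all_map.
case/and4P=> _ /allP okes /allP okds /allP okrs.
apply/and4P; split.
- by apply/allP=> e /okes /=; rewrite /liftable /= inE eqxx /= orbF.
- by apply/allP=> e /okds /=; rewrite /liftable /= inE eqxx /= orbF.
- by apply/allP=> r /okrs /=; rewrite /liftable /= !(mem_cat, inE) eqxx !orbT /=.
- rewrite /pending_size /= (_ : fsizes _ = fsizes fs) //.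
  by rewrite /fsizes !sumnE !big_map; apply: perm_big.
Qed.

Lemma fsizes_cat fs gs : fsizes (fs ++ gs) = fsizes fs + fsizes gs.
Proof. by rewrite /fsizes map_cat sumn_cat. Qed.

Lemma leq_fsize_conjoin fs : fsize (conjoin fs) <= 1 + 2 * fsizes fs.
Proof. by rewrite /fsizes; elim: fs => //= f fs IH; have := fsize_gt0 f; lia. Qed.

Lemma leq_fsizes_ackermann a rs :
  fsizes (ackermann rs) <= fsizes (rd_lits a rs) * fsizes (rd_lits a rs).
Proof.
elim: rs => // -[s t] rs IH; rewrite /= fsizes_cat.
have E : fsizes (rd_lits a ((s, t) :: rs)) = tsize s + tsize t + 3 + fsizes (rd_lits a rs).
  by rewrite /fsizes /=; lia.
have : fsizes [seq Imp (Eq t r.2) (Eq s r.1) | r <- rs] <=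
    (tsize s + tsize t + 3) * fsizes (rd_lits a rs).
  elim: rs {IH E} => // -[s' t'] rs IH; rewrite /fsizes /= -!/(fsizes _).
  by move: IH; rewrite /fsizes; nia.
by rewrite E; nia.
Qed.

Lemma tsize_wr_vec t js vs :
  size vs = size js ->
  tsize (wr_vec t js (map Var vs)) <= tsize t + 3 * sumn (map tsize js).
Proof.
rewrite /wr_vec; elim: js vs t => [|j js IH] [|v vs] t //=; first by lia.
by case=> /(IH vs (Wr t j (Var v))) /=; have := tsize_gt0 j; lia.
Qed.

Definition elim_weight (p : pending) : nat :=
  match p with
  | inl d => if nilp (d_eqs d) && nilp (d_diseqs d) then 2 else 3
  | inr _ => 1
  end.

Lemma elim_rule_step a B p es :
  elim_rule a p es -> elim_ok a B (20 * (B + 1) * (B + 1)) p ->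
  all (elim_ok a B (20 * (B + 1) * (B + 1))) es /\
  \sum_(e <- es) elim_weight e < elim_weight p.
Proof.
case=> {p es} [xs cs es1 js t es2 ds rs vs ft szvs _ _ _|xs cs d ds rs _ _|xs cs rs _ _].
- case/and5P=> _ _ _ _ /= leB; rewrite big_seq1 /= andbT; split; last by case: es1 {leB}.
  have le_js := leq_size_sumn_tsize js; have le_w := tsize_wr_vec t szvs.
  move: leB; rewrite /delta_conjs /= /eq_lits !fsizes_cat map_cat /= fsizes_cat.
  rewrite -[fsizes (_ :: _)]/((tsize (Var a) + _ + _).+1 + fsizes _) /=.
  set X := fsizes cs; set Y := fsizes _; set Z := fsizes _; set U := fsizes _; set W := fsizes _.
  move=> leB.
  set F := conjoin _; have le_F : fsize F <= 1 + 2 * B.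
    apply: leq_trans (leq_fsize_conjoin _) _.
    by rewrite map_cat !fsizes_cat -/X -/Y -/Z -/U -/W; lia.
  apply: (@leq_trans (B + (1 + 2 * B) * (3 * B))); last by nia.
  rewrite size_cat szvs; apply: leq_add; first by lia.
  by apply: leq_trans (fsize_repl_mul _ _ _) _; apply: leq_mul => //; lia.
- case/and5P=> /= -> _ _ -> leB; rewrite big_seq1 /=; split=> //; rewrite !andbT.
  move: leB; rewrite /delta_conjs /= !fsizes_cat -[fsizes (_ :: _)]/(_ + fsizes _).
  by rewrite fsizes_cat; lia.
- case/and5P=> /= _ _ _ _ leB; rewrite big_seq1 /= andbT; split=> //.
  have := leq_fsize_conjoin (cs ++ ackermann rs).
  have := leq_fsizes_ackermann a rs.
  move: leB; rewrite /delta_conjs /= !fsizes_cat => leB.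
  have := @leq_mul (fsizes (rd_lits a rs)) (fsizes (rd_lits a rs)) B B.
  by nia.
Qed.

Lemma tfree_only_read a t : tfree_of a t -> only_read_t a t.
Proof.
rewrite /tfree_of; elim: t => [x|t IHt i IHi|t IHt i IHi v IHv] /=;
  rewrite !inE ?mem_cat ?negb_or.
- by apply: contraNneq => ->.
- by case/and3P=> _ /IHt-> /IHi->; rewrite orbT.
- by case/and4P=> _ /IHt-> /IHi-> /IHv->.
Qed.

Lemma free_only_read a f : Var a \notin terms f -> only_read a f.
Proof.
elim: f => //= [t u|t js u|f IHf g IHg|f IHf g IHg|f IHf g IHg];
  rewrite ?mem_cat ?negb_or.
- by case/andP=> ? ?; rewrite !tfree_only_read.
- case/and3P=> ? fjs ?; rewrite !tfree_only_read // andbT.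
  apply/allP=> j jjs; apply: tfree_only_read; apply: contraNN fjs => aj.
  by apply/flatten_mapP; exists j.
all: by case/andP=> /IHf-> /IHg->.
Qed.

Lemma elim_rule_exists a B B' d :
  elim_ok a B B' (inl d) -> exists es, elim_rule a (inl d) es.
Proof.
case: d => xs cs [|[js t] es] ds rs /and5P[/= fc fes fds frs _]; last first.
  case/andP: fes => ft _.
  have [vs [szvs uvs svs frvs]] := fresh_vars a xs
    (delta_conjs a (Delta xs cs ([::] ++ (js, t) :: es) ds rs)) (val_sort a) (size js).
  by eexists; apply: (ElimEq (es1 := [::])) ft szvs uvs svs frvs.
case: ds fds => [_|d ds fds]; first by eexists; apply: Ackermann.
eexists; apply: ElimDiseq => //; rewrite all_cat all_map; apply/andP; split.
  apply/allP=> f /(allP fc); exact: free_only_read.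
apply/allP=> r /(allP frs) /andP[f1 f2] /=.
by rewrite !tfree_only_read ?eqxx.
Qed.

(** * Runs of the procedure *)

Lemma leq_size_sum (T : Type) (W : T -> nat) (s : seq T) :
  (forall x, 0 < W x) -> size s <= \sum_(x <- s) W x.
Proof.
move=> W0; elim: s => [|x s IH]; rewrite ?big_cons //=.
by have := W0 x; lia.
Qed.

Lemma leq_sum_size (T : Type) (W : T -> nat) (b k : nat) (s : seq T) :
  all (fun x => W x <= b) s -> size s <= k -> \sum_(x <- s) W x <= k * b.
Proof.
move=> Wb sk; apply: (@leq_trans (size s * b)); last by rewrite leq_mul2r sk orbT.
elim: s Wb {sk} => [|x s IH] /=; first by rewrite big_nil.
by case/andP=> xb /IH; rewrite big_cons mulSn; lia.
Qed.

(* [bn] bounds the index vectors and ranks of array atoms, [bD] the potential of a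
   disjunct and [bB] its size during normalisation.  The B's bound the size of a
   disjunct and the N's the weighted number of disjuncts in the later phases. *)
Record bounds := Bounds { bn : nat; bD : nat; bB : nat }.

Definition B2 b := bB b + 2 * bD b.
Definition B3 b := 6 * B2 b.
Definition B4 b := 20 * (B3 b + 1) * (B3 b + 1).
Definition N1 b := 3 ^ bD b.
Definition N2 b := N1 b * 3 ^ bD b.
Definition N3 b := N2 b * B2 b.
Definition N4 b := N3 b * 3 ^ (4 * bD b).
Definition N5 b := N4 b * 3.

Definition bounded_norm_ok (b : bounds) (f : formula) : bool :=
  [&& norm_ok (bn b) f, npot (2 * bn b + 10) f <= bD b
    & fsize f * (bn b + 5) ^ npot (2 * bn b + 10) f <= bB b].

Definition state_ok (a : var) (b : bounds) (s : state) : bool :=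
  match s with
  | Normalise ds => all (bounded_norm_ok b) ds &&
      (\sum_(d <- ds) 3 ^ npot (2 * bn b + 10) d <= N1 b)
  | Split ds => all (split_ok a (bD b) (B2 b)) ds &&
      (\sum_(d <- ds) 3 ^ size (atoms (body d)) <= N2 b)
  | Factor ds => all (factor_ok a (bD b) (B2 b)) ds &&
      (\sum_(d <- ds) (fsize (body d) + fsizes (lits d)) <= N3 b)
  | Lift cs => all (lift_ok a (B3 b)) cs && (\sum_(c <- cs) 3 ^ conns c.2 <= N4 b)
  | Eliminate ps => all (elim_ok a (B3 b) (B4 b)) ps &&
      (\sum_(p <- ps) elim_weight p <= N5 b)
  | Return rs => \sum_(r <- rs) (size r.1 + fsize r.2) <= N5 b * B4 b
  end.

Definition state_rank (b : bounds) (s : state) : nat :=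
  match s with
  | Normalise ds => 5 * (N5 b).+1 + \sum_(d <- ds) 3 ^ npot (2 * bn b + 10) d
  | Split ds => 4 * (N5 b).+1 + \sum_(d <- ds) 3 ^ size (atoms (body d))
  | Factor ds => 3 * (N5 b).+1 + \sum_(d <- ds) (fsize (body d) + fsizes (lits d))
  | Lift cs => 2 * (N5 b).+1 + \sum_(c <- cs) 3 ^ conns c.2
  | Eliminate ps => (N5 b).+1 + \sum_(p <- ps) elim_weight p
  | Return rs => 0
  end.

Lemma bounds_mono b : 0 < bB b ->
  [/\ N1 b <= N2 b, N2 b <= N3 b, N3 b <= N4 b & N4 b <= N5 b] /\
  [/\ bB b <= B2 b, B2 b <= B3 b & B3 b <= B4 b].
Proof.
move=> B0; have p3 k : 0 < 3 ^ k by rewrite expn_gt0.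
split; split; rewrite ?leq_pmulr ?leq_addr //.
- by rewrite /B2; lia.
- by rewrite /B4; move: (B3 b) => c; nia.
Qed.

Lemma bounded_norm_rule_step b f es :
  norm_rule f es -> bounded_norm_ok b f ->
  all (bounded_norm_ok b) es /\
  \sum_(e <- es) 3 ^ npot (2 * bn b + 10) e < 3 ^ npot (2 * bn b + 10) f.
Proof.
move=> fes /and3P[okf leD leB]; have [sz step] := norm_rule_step fes okf.
split; last by apply: sum_pow3_lt => //; apply/allP=> e /step[].
apply/allP=> e /step[oke lt_e sz_e]; apply/and3P; split=> //; first by lia.
apply: leq_trans leB; move: lt_e; case: (npot _ f) => // p; rewrite ltnS => lt_e.
apply: (@leq_trans ((bn b + 5) * fsize f * (bn b + 5) ^ p)).
  by apply: leq_mul => //; apply: leq_pexp2l => //; lia.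
by rewrite expnS; lia.
Qed.

Lemma atoms_npot K f : nconn f + size (atoms f) <= npot K f.
Proof.
rewrite /npot /weight -addnA leq_add2l; apply: leq_trans (leq_addr _ _).
have : all (fun p => 0 < apot K p) (atoms f).
  by apply/allP=> p /is_atom; case: p.
by elim: (atoms f) => //= p s IH /andP[p0 /IH]; rewrite big_cons; lia.
Qed.

Lemma fsize_norm_ok b f : bounded_norm_ok b f -> fsize f <= bB b.
Proof.
case/and3P=> _ _; apply: leq_trans; apply: leq_pmulr.
by rewrite expn_gt0 addnC.
Qed.

Lemma normalised_split_ok a I V b f :
  a.1 = Arr I V -> bounded_norm_ok b f -> (forall es, ~ norm_rule f es) ->
  split_ok a (bD b) (B2 b) (Disjunct [::] f [::] [::]).
Proof.
move=> aE okf nof; have szf := fsize_norm_ok okf.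
case/and3P: okf => /andP[wf _] leD _.
have := atoms_npot (2 * bn b + 10) f.
by rewrite /split_ok /= (norm_fixed_normal aE wf nof) /B2 /fsizes /=; lia.
Qed.

Lemma split_factor_ok a D B d :
  split_ok a D B d -> (forall es, ~ split_rule a d es) -> factor_ok a D B d.
Proof.
move=> okd nod; have ord := split_fixed_only_read okd nod.
case: d okd ord {nod} => xs f ls rs /and5P[/= /nilP-> /nilP-> _ okl /andP[leD leB]] ord.
by rewrite /factor_ok /= ord okl; move: leB; rewrite /fsizes /=; lia.
Qed.

Lemma lifted_all_elim_ok a B B' cs ds :
  List.Forall2 (lifted a) cs ds -> all (lift_ok a B) cs ->
  size ds = size cs /\ all (elim_ok a B B') (map inl ds).
Proof.
elim=> // {cs ds} c d cs ds cd _ IH /andP[okc /IH[szE okds]].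
by rewrite /= szE okds andbT; split=> //; apply: lifted_elim_ok okc cd.
Qed.

Lemma step_ok a I V b s s' :
  a.1 = Arr I V -> 0 < bB b -> step a s s' -> state_ok a b s ->
  state_ok a b s' /\ state_rank b s' < state_rank b s.
Proof.
move=> aE B0; have [[N12 N23 N34 N45] [B12 B23 B34]] := bounds_mono B0.
have p3 k : 0 < 3 ^ k by rewrite expn_gt0.
case=> {s s'} [ds ds' st|ds fx|ds ds' st|ds fx|ds ds' st|ds fx|cs cs' st|cs ds li|ps ps' st|rs].
- case/andP=> okds leN; have := in_disjunct_step (@bounded_norm_rule_step b) st okds.
  by case=> okds' lt_ds; rewrite /= okds' /=; lia.
- case/andP=> okds leN.
  have okds' : all (split_ok a (bD b) (B2 b)) [seq Disjunct [::] f [::] [::] | f <- ds].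
    rewrite all_map; apply: fixed_point_all fx okds => f okf nof.
    exact: normalised_split_ok aE okf nof.
  have le_ds : \sum_(d <- [seq Disjunct [::] f [::] [::] | f <- ds])
      3 ^ size (atoms (body d)) <= N2 b.
    rewrite big_map; apply: leq_sum_size; last first.
      by apply: leq_trans leN; apply: leq_size_sum.
    apply/allP=> f /(allP okds) /and3P[_ leD _]; rewrite leq_exp2l //.
    by have := atoms_npot (2 * bn b + 10) f => /=; lia.
  by rewrite /= okds' le_ds; split=> //; lia.
- case/andP=> okds leN; have := in_disjunct_step (@split_rule_step a _ _) st okds.
  by case=> okds' lt_ds; rewrite /= okds' /=; lia.
- case/andP=> okds leN.
  have okds' : all (factor_ok a (bD b) (B2 b)) ds.
    by apply: fixed_point_all fx okds => d; apply: split_factor_ok.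
  have le_ds : \sum_(d <- ds) (fsize (body d) + fsizes (lits d)) <= N3 b.
    apply: leq_sum_size; last by apply: leq_trans leN; apply: leq_size_sum.
    by apply: sub_all okds => d /and5P[_ _ _ _ /andP[_]]; lia.
  by rewrite /= okds' le_ds; split=> //; lia.
- case/andP=> okds leN; have := in_disjunct_step (@factor_rule_step a _ _) st okds.
  by case=> okds' lt_ds; rewrite /= okds' /=; lia.
- case/andP=> okds leN.
  have : all (fun c => lift_ok a (B3 b) c && (conns c.2 <= 4 * bD b)) (map clause_of ds).
    rewrite all_map; apply: fixed_point_all fx okds => d okd nod.
    exact: factor_fixed_liftable okd nod.
  rewrite all_predI => /andP[okcs le_cs].
  have le_ds : \sum_(c <- map clause_of ds) 3 ^ conns c.2 <= N4 b.
    apply: leq_sum_size; first by apply: sub_all le_cs => c; rewrite leq_exp2l.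
    rewrite size_map; apply: leq_trans leN; apply: leq_size_sum => d.
    by have := fsize_gt0 (body d); lia.
  by rewrite /= okcs le_ds; split=> //; lia.
- case/andP=> okcs leN; have := in_disjunct_step (@lift_rule_step a _) st okcs.
  by case=> okcs' lt_cs; rewrite /= okcs' /=; lia.
- case/andP=> okcs leN; have [szE okds] := lifted_all_elim_ok (B4 b) li okcs.
  have le_ds : \sum_(p <- map inl ds) elim_weight p <= N5 b.
    apply: leq_sum_size; first by rewrite (@eq_all _ _ predT) ?all_predT // => -[d|r] //=;
      case: ifP.
    by rewrite size_map szE; apply: leq_trans leN; apply: leq_size_sum.
  split; first by rewrite /= okds.
  by apply: leq_ltn_trans (leq_add (leqnn _) le_ds) _; rewrite /=; lia.
- case/andP=> okps leN; have := in_disjunct_step (@elim_rule_step a _) st okps.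
  by case=> okps' lt_ps; rewrite /= okps' /=; lia.
- case/andP=> okps leN; split=> //=; apply: leq_sum_size.
    move: okps; rewrite all_map; apply: sub_all => -[xs f] //.
  rewrite -(@size_map _ pending inr rs); apply: leq_trans leN; apply: leq_size_sum.
  by case=> // d /=; case: ifP.
Qed.

Lemma state_size_ok a b s : 0 < bB b -> state_ok a b s -> state_size a s <= N5 b * B4 b.
Proof.
move=> B0; have [[N12 N23 N34 N45] [B12 B23 B34]] := bounds_mono B0.
have p3 k : 0 < 3 ^ k by rewrite expn_gt0.
case: s => [ds|ds|ds|cs|ps|rs] /=; rewrite ?/fsizes sumnE big_map.
- case/andP=> okds leN; apply: leq_sum_size.
    by apply: sub_all okds => f /fsize_norm_ok; lia.
  by apply: leq_trans (leq_size_sum _ _) (leq_trans leN _) => //; lia.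
- case/andP=> okds leN; apply: leq_sum_size.
    apply: sub_all okds => -[xs f ls rs] /and5P[/= /nilP-> /nilP-> _ _ /andP[_]].
    by rewrite /disjunct_size /fsizes /=; lia.
  by apply: leq_trans (leq_size_sum _ _) (leq_trans leN _) => //; lia.
- case/andP=> okds leN; apply: leq_sum_size.
    apply: sub_all okds => -[xs f ls rs] /and5P[/= _ _ _ _].
    by move: B34; rewrite /disjunct_size /fsizes /B3 /=; lia.
  apply: leq_trans (leq_size_sum _ _) (leq_trans leN _) => //; last by lia.
  by move=> d; have := fsize_gt0 (body d); lia.
- case/andP=> okcs leN; apply: leq_sum_size.
    by apply: sub_all okcs => c /andP[_]; rewrite /fsizes; lia.
  by apply: leq_trans (leq_size_sum _ _) (leq_trans leN _) => //; lia.
- case/andP=> okps leN; apply: leq_sum_size.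
    by apply: sub_all okps => -[d /and5P[_ _ _ _]|r /=]; lia.
  apply: leq_trans (leq_size_sum _ _) leN => //.
  by case=> // d /=; case: ifP.
- by [].
Qed.

Lemma exec_ok a I V b s n s' :
  a.1 = Arr I V -> 0 < bB b -> exec a s n s' -> state_ok a b s ->
  state_ok a b s' /\ n <= state_rank b s * (1 + 2 * (N5 b * B4 b)).
Proof.
move=> aE B0; elim=> {s n s'} [//|s s' s'' n st _ IH oks].
have [oks' lt_s] := step_ok aE B0 st oks; have [oks'' le_n] := IH oks'.
split=> //; have := state_size_ok B0 oks; have := state_size_ok B0 oks'.
have := leq_mul lt_s (leqnn (1 + 2 * (N5 b * B4 b))); rewrite mulSn; lia.
Qed.

Lemma all_inl_inr (ps : seq pending) :
  (exists rs, ps = map inr rs) \/ exists l d r, ps = l ++ inl d :: r.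
Proof.
elim: ps => [|[d|r] ps [[rs psE]|[l [d' [r' psE]]]]].
- by left; exists [::].
- by right; exists [::], d, ps.
- by right; exists [::], d, ps.
- by left; exists (r :: rs); rewrite psE.
- by right; exists (inr r :: l), d', r'; rewrite psE.
Qed.

Lemma step_progress a b s :
  state_ok a b s -> returned s \/ exists s', step a s s'.
Proof.
case: s => [ds|ds|ds|cs|ps|rs] /=; last by left.
- have [[ds' st]|fx] := classic (exists ds', in_disjunct norm_rule ds ds'); right.
    by exists (Normalise ds'); constructor.
  by eexists; apply: end_norm.
- have [[ds' st]|fx] := classic (exists ds', in_disjunct (split_rule a) ds ds'); right.
    by exists (Split ds'); constructor.
  by eexists; apply: end_split.
- have [[ds' st]|fx] := classic (exists ds', in_disjunct (factor_rule a) ds ds'); right.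
    by exists (Factor ds'); constructor.
  by eexists; apply: end_factor.
- case/andP=> okcs _; right.
  have [|ds li] := @lifted_exists_all a cs; first by apply: sub_all okcs => c /andP[].
  by exists (Eliminate (map inl ds)); constructor.
- case/andP=> okps _; right; have [[rs ->]|[l [d [r psE]]]] := all_inl_inr ps.
    by exists (Return rs); constructor.
  move: okps; rewrite psE all_cat => /and3P[_ okd _].
  have [es des] := elim_rule_exists okd.
  by exists (Eliminate (l ++ es ++ r)); constructor; exists l, (inl d), r, es.
Qed.

Definition init_bounds (n D : nat) : bounds := Bounds n D (n * (n + 5) ^ D).

Lemma init_ok a f D :
  well_sorted f -> npot (2 * fsize f + 10) f <= D ->
  state_ok a (init_bounds (fsize f) D) (init f).
Proof.
move=> wf leD; rewrite /= big_seq1 /N1 /= leq_exp2l // leD /bounded_norm_ok /=.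
by rewrite norm_ok_init // leD !andbT /= leq_mul2l leq_pexp2l ?orbT //; lia.
Qed.

Lemma total_time_bound b x :
  bB b <= 2 ^ (7 * x) -> bD b <= x -> 5 <= x ->
  6 * (N5 b).+1 * (1 + 2 * (N5 b * B4 b)) <= 2 ^ (67 * x).
Proof.
move=> leB leD x5.
have p2 y z : y <= z -> 2 ^ y <= 2 ^ z by move=> ?; rewrite leq_exp2l.
have p3 k : 3 ^ k <= 2 ^ (2 * k) by rewrite expnM; case: k => // k; rewrite leq_exp2r.
have pM c d y z t : c <= 2 ^ y -> d <= 2 ^ z -> y + z <= t -> c * d <= 2 ^ t.
  by move=> cy dz /p2; apply: leq_trans; rewrite expnD leq_mul.
have pD c d y t : c <= 2 ^ y -> d <= 2 ^ y -> y.+1 <= t -> c + d <= 2 ^ t.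
  by move=> cy dy /p2; apply: leq_trans; rewrite expnS; lia.
have pC k c t : c <= 2 ^ (k * x) -> k.+1 * x <= t -> 32 * c <= 2 ^ t.
  by move=> ck le_t; apply: (pM _ _ 5 _ _ _ ck) => //; lia.
have hB2 : B2 b <= 2 ^ (8 * x).
  have h : 2 * bD b <= 2 ^ (7 * x).
    by apply: ltnW; apply: leq_trans (ltn_expl (7 * x) (ltnSn 1)); lia.
  by apply: (pD _ _ _ _ leB h); lia.
have hB3 : B3 b + 1 <= 2 ^ (9 * x).
  have := pC _ _ (9 * x) hB2 (leqnn _); rewrite /B3.
  have := expn_gt0 2 (9 * x); have := p2 (8 * x + 5) (9 * x).
  case: (B2 b) => [|c]; lia.
have hB4 : B4 b <= 2 ^ (20 * x).
  apply: (pM _ _ (10 * x) _ _ _ hB3); last by lia.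
  by have := pC _ _ (10 * x) hB3 (leqnn _); lia.
have hN1 : N1 b <= 2 ^ (2 * x).
  by apply: leq_trans (p3 _) (p2 _ _ _); lia.
have hN2 : N2 b <= 2 ^ (4 * x) by apply: (pM _ _ _ _ _ hN1 hN1); lia.
have hN3 : N3 b <= 2 ^ (12 * x) by apply: (pM _ _ _ _ _ hN2 hB2); lia.
have hN4 : N4 b <= 2 ^ (20 * x).
  apply: (pM _ _ _ (8 * x) _ hN3); last by lia.
  by apply: leq_trans (p3 _) (p2 _ _ _); lia.
have hN5 : N5 b <= 2 ^ (21 * x).
  by have := pC _ _ (21 * x) hN4 (leqnn _); rewrite /N5; lia.
have hN6 : 6 * (N5 b).+1 <= 2 ^ (23 * x).
  have h : (N5 b).+1 <= 2 ^ (22 * x).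
    by rewrite -addn1; apply: (pD _ _ _ _ hN5); [rewrite expn_gt0|lia].
  by have := pC _ _ (23 * x) h (leqnn _); lia.
have hNB : N5 b * B4 b <= 2 ^ (41 * x) by apply: (pM _ _ _ _ _ hN5 hB4); lia.
apply: (pM _ _ _ (43 * x) _ hN6); last by lia.
have h : 2 * (N5 b * B4 b) <= 2 ^ (42 * x).
  by have := pC _ _ (42 * x) hNB (leqnn _); lia.
by rewrite addnC; apply: (pD _ _ _ _ h); [rewrite expn_gt0|lia].
Qed.

Theorem theorem2 :
  exists c k : nat,
    forall (phi : formula) (a : var) (I : nat) (V : asort),
      well_sorted phi ->
      quantifier_free phi ->
      a.1 = Arr I V ->
      terminates_within a phi (2 ^ (c * fsize phi ^ k)).
Proof.
exists (67 * 128), 5 => f a I V wf _ aE n s run.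
have [n0 leD] := (fsize_gt0 f, leq_npot_init f).
have {leD}[D leD DE] : exists2 D, npot (2 * fsize f + 10) f <= D & D = 128 * fsize f ^ 4.
  by eexists; [exact: leD|].
have := init_ok a wf leD; set b := init_bounds _ _ => okb.
have B0 : 0 < bB b by rewrite muln_gt0 n0 expn_gt0 addnC.
have [oks le_n] := exec_ok aE B0 run okb.
split; last exact: step_progress oks.
apply: leq_trans le_n _.
have le_rank : state_rank b (init f) <= 6 * (N5 b).+1.
  have [[? ? ? ?] _] := bounds_mono B0.
  by have /andP[_] := okb; rewrite /=; lia.
apply: leq_trans (leq_mul le_rank (leqnn _)) _.
have D0 : 127 < D by rewrite DE; apply: leq_pmulr; rewrite expn_gt0 n0.
have -> : 67 * 128 * fsize f ^ 5 = 67 * (fsize f * D) by rewrite DE expnS; lia.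
apply: total_time_bound.
- rewrite /b /=; move: (fsize f) n0 => m m0.
  have le_m k : k <= 2 ^ k by apply/ltnW/ltn_expl.
  apply: (@leq_trans (2 ^ m * 2 ^ (6 * m * D))).
    apply: leq_mul (le_m _) _; rewrite [X in _ <= X]expnM.
    case: (D) => // D'; rewrite leq_exp2r //.
    by apply: leq_trans (le_m _) _; rewrite leq_exp2l //; lia.
  by rewrite -expnD leq_exp2l //; nia.
- by rewrite /b /= leq_pmull.
- by apply: leq_trans (leq_pmull _ n0); lia.
Qed.
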